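(* Let $\Omega$ be an alphabet, and let $P$ be a computable finite probability space on $\Omega$. Let $X\colon\Omega\to\mathbb{R}$ be an arbitrary real random variable on $\Omega$. Let $\alpha\in\Omega^\infty$ be Schnorr $P$-random. Let $\varepsilon$ be an arbitrary positive real. Then there exists $M\in\mathbb{N}^+$ such that for every integer $n\ge M$ and every $k\in\mathbb{N}^+$, if $k\ge n^{2+\varepsilon}$ then $$\left|\frac{1}{k}\sum_{i=1}^k X(\alpha(i))-E(X)\right|<\frac{1}{n}.$$
   Context: $\mathbb{N}=\{0,1,2,\dots\}$ and $\mathbb{N}^+$ is the set of positive integers. An alphabet is a non-empty finite set. For an alphabet $\Omega$, $\Omega^*$ is the set of finite strings over $\Omega$ (including the empty string) and $\Omega^\infty$ is the set of infinite sequences $\alpha=\alpha(1)\alpha(2)\cdots$ over $\Omega$; $\alpha(i)$ is the $i$th element and $\alpha\restriction_n$ is the string of the first $n$ elements of $\alpha$. For $S\subset\Omega^*$, $[S]^{\prec}=\{\alpha\in\Omega^\infty\mid \exists n\in\mathbb{N}\ \alpha\restriction_n\in S\}$. A finite probability space on $\Omega$ is a function $P\colon\Omega\to\mathbb{R}$ with $P(a)\ge 0$ for all $a\in\Omega$ and $\sum_{a\in\Omega}P(a)=1$. A real $x$ is computable if there is a total recursive $f\colon\mathbb{N}\to\mathbb{Q}$ with $|x-f(k)|<2^{-k}$ for all $k\in\mathbb{N}$; $P$ is computable if $P(a)$ is a computable real for every $a\in\Omega$. The Bernoulli measure $\lambda_P$ is the probability measure on the Borel $\sigma$-field of $\Omega^\infty$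 (generated by all sets $[S]^{\prec}$) with $\lambda_P([\{\sigma_1\cdots\sigma_n\}]^{\prec})=P(\sigma_1)\cdots P(\sigma_n)$ for every string $\sigma_1\cdots\sigma_n\in\Omega^*$. A real random variable on $\Omega$ is a function $X\colon\Omega\to\mathbb{R}$, and its mean is $E(X)=\sum_{a\in\Omega}X(a)P(a)$. A Martin-Löf $P$-test is an r.e. (recursively enumerable) set $\mathcal{C}\subset\mathbb{N}^+\times\Omega^*$ such that $\lambda_P([\mathcal{C}_n]^{\prec})<2^{-n}$ for every $n\in\mathbb{N}^+$, where $\mathcal{C}_n=\{\sigma\mid(n,\sigma)\in\mathcal{C}\}$. A Schnorr $P$-test is a Martin-Löf $P$-test $\mathcal{C}$ for which there is a total recursive $f\colon\mathbb{N}^+\times\mathbb{N}\to\mathbb{Q}$ with $|\lambda_P([\mathcal{C}_n]^{\prec})-f(n,k)|<2^{-k}$ for all $n\in\mathbb{N}^+$, $k\in\mathbb{N}$. A sequence $\alpha\in\Omega^\infty$ passes $\mathcal{C}$ if $\alpha\notin[\mathcal{C}_n]^{\prec}$ for some $n\in\mathbb{N}^+$. $\alpha$ is Schnorr $P$-random if it passes every Schnorr $P$-test. *)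

(* Defs.v *)
From HB Require Import structures.
From mathcomp Require Import all_boot all_order all_algebra.
From mathcomp Require Import all_classical all_reals all_analysis.

Set Implicit Arguments.
Unset Strict Implicit.
Unset Printing Implicit Defensive.

Import Order.TTheory GRing.Theory Num.Theory.
Import numFieldNormedType.Exports.

Local Open Scope classical_set_scope.
Local Open Scope ring_scope.

(** * Recursive functions and r.e. sets *)

(* Kleene's partial recursive functions.  A partial function is an
   [option]-valued function, [None] meaning "undefined"; the last three clauses
   characterise the graph of the function being built, so that the class does
   not depend on how that function is written. *)
Inductive partial_recursive :
    forall n : nat, (n.-tuple nat -> option nat) -> Prop :=
| pr_zero n : partial_recursive (fun _ : n.-tuple nat => Some 0%N)
| pr_succ : partial_recursive (fun x : 1.-tuple nat => Some (thead x).+1)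
| pr_proj n (i : 'I_n) :
    partial_recursive (fun x : n.-tuple nat => Some (tnth x i))
| pr_comp m n (g : m.-tuple nat -> option nat)
    (h : 'I_m -> n.-tuple nat -> option nat) (f : n.-tuple nat -> option nat) :
    partial_recursive g -> (forall i, partial_recursive (h i)) ->
    (forall x y, f x = Some y <->
       exists2 z : m.-tuple nat,
         (forall i, h i x = Some (tnth z i)) & g z = Some y) ->
    partial_recursive f
| pr_rec n (g : n.-tuple nat -> option nat) (h : n.+2.-tuple nat -> option nat)
    (f : n.+1.-tuple nat -> option nat) :
    partial_recursive g -> partial_recursive h ->
    (forall x, f (cons_tuple 0%N x) = g x) ->
    (forall k x, f (cons_tuple k.+1 x) =
       obind (fun y => h (cons_tuple k (cons_tuple y x)))
             (f (cons_tuple k x))) ->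
    partial_recursive f
| pr_mu n (g : n.+1.-tuple nat -> option nat) (f : n.-tuple nat -> option nat) :
    partial_recursive g ->
    (forall x y, f x = Some y <->
       g (cons_tuple y x) = Some 0%N /\
       forall z, (z < y)%N -> exists v, g (cons_tuple z x) = Some v.+1) ->
    partial_recursive f.

Definition total_recursive n (f : n.-tuple nat -> nat) : Prop :=
  partial_recursive (fun x => Some (f x)).

Definition re_set n (S : set (n.-tuple nat)) : Prop :=
  exists2 g : n.-tuple nat -> option nat,
    partial_recursive g & forall x, S x <-> g x <> None.

(* The value is produced as a difference of two natural numbers over a positive
   natural number; the fraction need not be reduced. *)
Definition total_recursive_rat n (f : n.-tuple nat -> rat) : Prop :=
  exists a b c : n.-tuple nat -> nat,
    [/\ total_recursive a, total_recursive b, total_recursive c &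
        forall x, f x = ((a x)%:R - (b x)%:R) / (c x).+1%:R].

Definition computable_real (R : realType) (x : R) : Prop :=
  exists2 f : nat -> rat,
    total_recursive_rat (fun v : 1.-tuple nat => f (tnth v ord0)) &
    forall k, `|x - ratr (f k)| < 2^-1 ^+ k.

(** * Alphabets, strings, infinite sequences *)

(* Non-empty finite types.  Non-emptiness is carried by a distinguished point
   only because the library's measurable types have to be pointed. *)
#[short(type="alphabetType")]
HB.structure Definition Alphabet := {T of Finite T & isPointed T}.

(* [alpha i] is the (i+1)st letter of [alpha]. *)
Definition prefix_set (Omega : Type) (S : set (seq Omega)) :
  set (nat -> Omega) := [set alpha | exists n, S (mkseq alpha n)].

Definition iseq (Omega : alphabetType) :=
  g_sigma_algebraType (range (@prefix_set Omega)).

(* [CodeSeq.code] is an effective bijection from [seq nat] onto [nat]. *)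
Definition string_code (Omega : finType) (s : seq Omega) : nat :=
  CodeSeq.code [seq nat_of_ord (enum_rank a) | a <- s].

(** * Finite probability spaces and Bernoulli measures *)

Record finProbSpace (R : realType) (Omega : alphabetType) := FinProbSpace {
  fps_fun :> Omega -> R ;
  fps_ge0 : forall a, 0 <= fps_fun a ;
  fps_sum1 : \sum_a fps_fun a = 1 }.

Definition computable_fps (R : realType) (Omega : alphabetType)
  (P : finProbSpace R Omega) : Prop := forall a, computable_real (P a).

Definition mean (R : realType) (Omega : alphabetType)
  (P : finProbSpace R Omega) (X : Omega -> R) : R := \sum_a X a * P a.

Section bernoulli_existence.
Variables (R : realType) (Omega : alphabetType) (P : finProbSpace R Omega).

(* The measure is built as the image of Lebesgue measure on [0, 1[ under the map
   [Phi]: [0, 1[ is cut into intervals of lengths [P a], the letter read off is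
   the one whose interval contains the point, and that interval is rescaled to
   [0, 1[ before reading the next letter. *)
Let c (a : Omega) : R := \sum_(b | (enum_rank b < enum_rank a)%N) P b.
Let inI (a : Omega) (x : R) : bool := (c a <= x < c a + P a).
Let digit (x : R) : Omega := odflt point [pick a | inI a x].
Let step (x : R) : R := (x - c (digit x)) / P (digit x).
Let U : set R := `[0, 1[.
Let Phi (x : R) : iseq Omega :=
  if (0 <= x < 1) then (fun n => digit (iter n step x)) else (fun=> point).

Let c_ge0 a : 0 <= c a.
Proof. by apply: sumr_ge0 => b _; exact: fps_ge0. Qed.

Let cD a : c a + P a = \sum_(b | (enum_rank b <= enum_rank a)%N) P b.
Proof.
rewrite [RHS](bigD1 a) //= addrC; congr (_ + _); apply: eq_bigl => b.
by rewrite ltn_neqAle andbC (inj_eq val_inj) (inj_eq enum_rank_inj).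
Qed.

Let cD_le1 a : c a + P a <= 1.
Proof.
rewrite cD -(fps_sum1 P) [leRHS](bigID (fun b => (enum_rank b <= enum_rank a)%N))/=.
by rewrite lerDl sumr_ge0// => b _; exact: fps_ge0.
Qed.

Let c_mono a b : (enum_rank a < enum_rank b)%N -> c a + P a <= c b.
Proof.
move=> ab; rewrite cD /c.
rewrite [leRHS](bigID (fun d => (enum_rank d <= enum_rank a)%N))/=.
rewrite [X in X + _](eq_bigl (fun d => (enum_rank d <= enum_rank a)%N)).
  by rewrite lerDl sumr_ge0// => d _; exact: fps_ge0.
move=> d /=; case: (leqP (enum_rank d) (enum_rank a)) => h; rewrite ?andbF//.
by rewrite (leq_ltn_trans h ab).
Qed.

Let inI_uniq a b x : inI a x -> inI b x -> a = b.
Proof.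
move=> /andP[a1 a2] /andP[b1 b2].
have [ab|ba|/val_inj/enum_rank_inj//] :=
  ltngtP (enum_rank a) (enum_rank b); exfalso.
- by have := lt_le_trans a2 (le_trans (c_mono ab) b1); rewrite ltxx.
- by have := lt_le_trans b2 (le_trans (c_mono ba) a1); rewrite ltxx.
Qed.

Let inI_cover x : 0 <= x < 1 -> exists a, inI a x.
Proof.
move=> /andP[x0 x1].
pose Q (a : Omega) := x < c a + P a.
have exQ : exists a, Q a.
  apply/existsP/contraT; rewrite negb_exists => /forallP nQ.
  have n0 : (0 < #|Omega|)%N by apply/card_gt0P; exists point.
  have nn : (#|Omega|.-1 < #|Omega|)%N by rewrite ltn_predL.
  have := nQ (enum_val (Ordinal nn)).
  rewrite /Q cD enum_valK -leNgt (eq_bigl xpredT) ?fps_sum1.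
    by move=> /(lt_le_trans x1); rewrite ltxx.
  by move=> b /=; rewrite -ltnS prednK// ltn_ord.
case: exQ => a0 Qa0.
pose a := [arg min_(b < a0 | Q b) nat_of_ord (enum_rank b)]%N.
exists a; rewrite /a; case: arg_minnP => // b Qb minb.
apply/andP; split => //.
case Eb : (nat_of_ord (enum_rank b)) => [|m].
  by rewrite /c big_pred0// => d; rewrite Eb ltn0.
have lm : (m < #|Omega|)%N by rewrite (ltn_trans _ (ltn_ord (enum_rank b)))// Eb.
pose d := enum_val (Ordinal lm).
have Ed : nat_of_ord (enum_rank d) = m by rewrite /d enum_valK.
rewrite /c (eq_bigl (fun d' => (enum_rank d' <= enum_rank d)%N)); last first.
  by move=> d'; rewrite Eb Ed ltnS.
rewrite -cD leNgt; apply/negP => Qd.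
by have := minb d Qd; rewrite Eb Ed ltnn.
Qed.

Let digitE a x : 0 <= x < 1 -> (digit x == a) = inI a x.
Proof.
move=> x01; rewrite /digit; case: pickP => [b Ib|nI] /=.
  by apply/eqP/idP => [<-//|]; exact: inI_uniq.
by have [b] := inI_cover x01; rewrite nI.
Qed.

Let step01 x : 0 <= x < 1 -> 0 <= step x < 1.
Proof.
move=> x01; have /andP[h1 h2] : inI (digit x) x by rewrite -digitE.
have P0 : 0 < P (digit x) by rewrite -(ltrD2l (c (digit x))) addr0 (le_lt_trans h1).
by rewrite /step divr_ge0 ?subr_ge0 ?(ltW P0)//= ltr_pdivrMr// mul1r ltrBlDl.
Qed.

Let L : seq Omega -> R := foldr (fun a l => c a + P a * l) 0.
Let W (s : seq Omega) : R := \prod_(a <- s) P a.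

Let W_ge0 s : 0 <= W s.
Proof. by apply: prodr_ge0 => a _; exact: fps_ge0. Qed.

Let LW s : 0 <= L s /\ L s + W s <= 1.
Proof.
elim: s => [|a s [l0 lw]]; first by rewrite /W big_nil /= add0r.
split=> /=; first by rewrite addr_ge0// mulr_ge0// fps_ge0.
rewrite /W big_cons -/(W s) -addrA -mulrDr (le_trans _ (cD_le1 a))//.
by rewrite lerD2l ler_piMr// fps_ge0.
Qed.

Let cylE s x : 0 <= x < 1 ->
  (mkseq (fun n => digit (iter n step x)) (size s) == s) =
  (L s <= x < L s + W s).
Proof.
elim: s x => [|a s IH] x x01.
  by rewrite /W big_nil /= add0r x01 eqxx.
rewrite /mkseq /= eqseq_cons digitE//.
have -> : [seq digit (iter n step x) | n <- iota 1 (size s)] =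
          mkseq (fun n => digit (iter n step (step x))) (size s).
  rewrite /mkseq (iotaDl 1 0) -map_comp; apply: eq_map => n /=.
  by rewrite -iterSr.
rewrite IH ?step01// /W big_cons -/(W s).
have [l0 lw] := LW s.
have [Ia|nIa] /= := boolP (inI a x).
  have /eqP da : digit x == a by rewrite digitE.
  have /andP[h1 h2] := Ia.
  have P0 : 0 < P a by rewrite -(ltrD2l (c a)) addr0 (le_lt_trans h1).
  rewrite /step da ler_pdivlMr// ltr_pdivrMr// lerBrDl ltrBlDl mulrDl.
  by rewrite addrA [L s * _]mulrC [W s * _]mulrC.
apply/esym/negbTE; apply: contra nIa => /andP[h1 h2].
rewrite /inI (le_trans _ h1) ?lerDl ?mulr_ge0 ?fps_ge0//=.
by rewrite (lt_le_trans h2)// -addrA -mulrDr lerD2l ler_piMr// fps_ge0.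
Qed.

Let prefix1E s : prefix_set [set s] =
  [set alpha : iseq Omega | mkseq alpha (size s) = s].
Proof.
apply/seteqP; split => [alpha [n /= h]|alpha /= h]; last by exists (size s).
by rewrite -[in RHS]h -h size_mkseq.
Qed.

Let preim_cyl s :
  Phi @^-1` (prefix_set [set s]) `&` U = `[L s, L s + W s[%classic.
Proof.
rewrite prefix1E; apply/seteqP; split => x /=; rewrite /U /= !in_itv/=.
  move=> [+ x01]; rewrite /Phi x01 => h.
  by rewrite -cylE// h.
move=> h; have [l0 lw] := LW s.
have x01 : 0 <= x < 1.
  by case/andP: h => h1 h2; rewrite (le_trans l0 h1) (lt_le_trans h2 lw).
by split=> //; rewrite /Phi x01; apply/eqP; rewrite cylE.
Qed.

Let mPhi : @measurable_fun _ _ (measurableTypeR R) (iseq Omega) setT Phi.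
Proof.
apply: (@measurability _ _ (measurableTypeR R) (iseq Omega) setT Phi
          (range (@prefix_set Omega))) => //.
move=> _ [_ [S _ <-] <-]; rewrite setTI.
have -> : Phi @^-1` prefix_set S =
    \bigcup_(s in S) (Phi @^-1` prefix_set [set s]).
  apply/seteqP; split => x /=.
    by move=> [n Sn]; exists (mkseq (Phi x) n) => //; exists n.
  by move=> [s Ss [n /= h]]; exists n; rewrite h.
rewrite bigcup_mkcond; apply: countable_bigcupT_measurable => [|s].
  exact: countableP.
case: ifPn => _; last exact: measurable0.
rewrite -(setIT (Phi @^-1` _)) -(setUv U) setIUr preim_cyl.
apply: measurableU; first exact: measurable_itv.
have mUC : measurable (~` U : set (measurableTypeR R)).
  by apply: measurableC; exact: measurable_itv.
have [h|h] := pselect (prefix_set [set s] (fun=> point : Omega)).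
  rewrite (_ : _ `&` _ = ~` U)//; apply/seteqP; split => [x []//|x nU].
  by split => //=; rewrite /Phi; case: ifPn => // x01; exfalso; apply: nU;
    rewrite /U /= in_itv.
rewrite (_ : Phi @^-1` prefix_set [set s] `&` ~` U = set0)//;
  apply/seteqP; split => // x [+ nU].
by rewrite /preimage /mkset /Phi; case: ifPn.
Qed.

Let mU : measurable (U : set (measurableTypeR R)).
Proof. exact: measurable_itv. Qed.

Lemma bernoulli_exists : exists lambda : probability (iseq Omega) R,
  forall s, lambda (prefix_set [set s]) = (\prod_(a <- s) P a)%:E.
Proof.
pose mu := mrestr (@lebesgue_measure R) mU.
have muT : (mu setT = 1)%E.
  transitivity (@lebesgue_measure R U).
    by rewrite -[in RHS](setTI U).
  by rewrite /U lebesgue_measure_itv /= lte_fin ltr01 sube0.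
pose muP : probability (measurableTypeR R) R :=
  HB.pack mu (Measure_isProbability.Build _ _ _ mu muT).
pose X : {mfun measurableTypeR R >-> iseq Omega} :=
  HB.pack Phi
    (isMeasurableFun.Build _ _ (measurableTypeR R) (iseq Omega) Phi mPhi).
exists (distribution muP X) => s.
transitivity (@lebesgue_measure R `[L s, L s + W s[%classic).
  by rewrite -preim_cyl.
rewrite lebesgue_measure_itv /= lte_fin ltrDl -EFinB [L s + _]addrC addrK.
case: ltP => // Ws; congr (_%:E).
by apply/eqP; rewrite eq_le Ws W_ge0.
Qed.

End bernoulli_existence.

(* The values on the cylinders determine the measure, hence the choice is
   immaterial. *)
Definition bernoulli_measure (R : realType) (Omega : alphabetType)
    (P : finProbSpace R Omega) : probability (iseq Omega) R :=
  projT1 (cid (bernoulli_exists P)).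

Lemma bernoulli_measureE (R : realType) (Omega : alphabetType)
    (P : finProbSpace R Omega) (s : seq Omega) :
  bernoulli_measure P (prefix_set [set s]) = (\prod_(a <- s) P a)%:E.
Proof. exact: (projT2 (cid (bernoulli_exists P))). Qed.

(** * Schnorr randomness *)

Definition test_section (Omega : Type) (C : set (nat * seq Omega)) (n : nat) :
  set (seq Omega) := [set s | C (n, s)].

Definition re_pairs (Omega : finType) (C : set (nat * seq Omega)) : Prop :=
  re_set [set [tuple p.1; string_code p.2] | p in C].

Definition martin_lof_test (R : realType) (Omega : alphabetType)
    (P : finProbSpace R Omega) (C : set (nat * seq Omega)) : Prop :=
  [/\ forall p, C p -> (0 < p.1)%N,
      re_pairs C &
      forall n, (0 < n)%N ->
        (bernoulli_measure P (prefix_set (test_section C n)) <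
           (2^-1 ^+ n)%:E)%E].

(* The function [f] is used on positive first arguments only, its values at [0]
   being irrelevant. *)
Definition schnorr_test (R : realType) (Omega : alphabetType)
    (P : finProbSpace R Omega) (C : set (nat * seq Omega)) : Prop :=
  martin_lof_test P C /\
  exists2 f : nat -> nat -> rat,
    total_recursive_rat
      (fun v : 2.-tuple nat => f (tnth v ord0) (tnth v ord_max)) &
    forall n k, (0 < n)%N ->
      `|fine (bernoulli_measure P (prefix_set (test_section C n)))
          - ratr (f n k)| < 2^-1 ^+ k.

Definition passes (Omega : Type) (alpha : nat -> Omega)
    (C : set (nat * seq Omega)) : Prop :=
  exists2 n, (0 < n)%N & ~ prefix_set (test_section C n) alpha.

Definition schnorr_random (R : realType) (Omega : alphabetType)
    (P : finProbSpace R Omega) (alpha : nat -> Omega) : Prop :=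
  forall C, schnorr_test P C -> passes alpha C.

(* Main.v *)
Require Import Defs.
From mathcomp Require Import all_boot all_order all_algebra.
From mathcomp Require Import all_classical all_reals all_analysis.
From mathcomp Require Import zify ring lra.

Set Implicit Arguments.
Unset Strict Implicit.
Unset Printing Implicit Defensive.

Import Order.TTheory GRing.Theory Num.Theory.
Import numFieldNormedType.Exports.

Local Open Scope classical_set_scope.
Local Open Scope ring_scope.

(** For a letter [a] of probability [p], Chernoff's bound makes the probability
    that the number of [a]'s among the first [k] letters differs from [k p] by at
    least [k ^ (1/2 + 1/(2m))] at most [B / k ^ 2].  Hence the events that
    such a deviation occurs at some [k > B 2 ^ (n + 1)] form a Martin-Loef test.  It is
    a Schnorr test: cutting off at [k <= L] changes the measure by at most
    [B / L], and what remains is a finite sum over binary words of length [L],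
    continuous in [p] with an explicit modulus.  As [alpha] passes this test for
    every letter, the averages of [X] converge at the rate
    [O(k ^ (- 1/2 + 1/(2m)))], and [m] is taken so large that this beats
    [k ^ (- 1 / (2 + eps)) <= 1 / n]. *)

(** * Recursive functions *)

(* Functions of an environment of de Bruijn-indexed variables; variables beyond
   the arity read as [0]. *)
Definition recursive (f : seq nat -> nat) : Prop :=
  forall n, total_recursive (fun x : n.-tuple nat => f x).

Lemma total_recursive_comp m n (g : m.-tuple nat -> nat)
    (h : 'I_m -> n.-tuple nat -> nat) :
  total_recursive g -> (forall i, total_recursive (h i)) ->
  total_recursive (fun x => g [tuple h i x | i < m]).
Proof.
move=> rg rh; apply: (pr_comp rg rh) => x y; split=> [[<-]|[z hz [<-]]].
  by exists [tuple h i x | i < m] => // i; rewrite tnth_mktuple.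
congr (Some (g _)); apply: eq_from_tnth => i; rewrite tnth_mktuple.
by have [] := hz i.
Qed.

Lemma recursive_var i : recursive (fun x => nth 0%N x i).
Proof.
move=> n; have [lin|nli] := ltnP i n.
  rewrite (_ : (fun x => _) = fun x => tnth x (Ordinal lin)); first exact: pr_proj.
  by apply/funext => x; rewrite (tnth_nth 0%N).
rewrite (_ : (fun x => _) = fun=> 0%N); first exact: pr_zero.
by apply/funext => x; rewrite nth_default// size_tuple.
Qed.

Lemma recursive_apply m (g : m.-tuple nat -> nat) (h : 'I_m -> seq nat -> nat) :
  total_recursive g -> (forall i, recursive (h i)) ->
  recursive (fun x => g [tuple h i x | i < m]).
Proof.
by move=> rg rh n; apply: (total_recursive_comp rg) => i; exact: rh.
Qed.

Lemma recursive_apply1 (g : 1.-tuple nat -> nat) f :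
  total_recursive g -> recursive f -> recursive (fun x => g [tuple f x]).
Proof.
move=> rg rf; have := recursive_apply rg (fun=> rf).
congr recursive; apply/funext => x; congr g.
by apply: eq_from_tnth => i; rewrite tnth_mktuple ord1.
Qed.

Lemma recursive_subst m (g : seq nat -> nat) (h : 'I_m -> seq nat -> nat) :
  recursive g -> (forall i, recursive (h i)) ->
  recursive (fun x => g [seq h i x | i : 'I_m]).
Proof. by move=> rg; exact: recursive_apply (rg m). Qed.

Lemma recursive_subst1 g f : recursive g -> recursive f ->
  recursive (fun x => g [:: f x]).
Proof. by move=> /(_ 1%N) rg rf; exact: (recursive_apply1 rg rf). Qed.

Lemma recursive_subst2 g f1 f2 : recursive g -> recursive f1 -> recursive f2 ->
  recursive (fun x => g [:: f1 x; f2 x]).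
Proof.
move=> rg r1 r2.
have := @recursive_subst 2 g (fun i => if val i is 0%N then f1 else f2) rg.
rewrite (_ : (fun x => _) = fun x => g [:: f1 x; f2 x]); last first.
  by apply/funext => x; rewrite /image_mem enum_ordSl enum_ordSl enum_ord0.
by apply=> -[[|i] ?].
Qed.

Lemma recursive_succ f : recursive f -> recursive (fun x => (f x).+1).
Proof. by move=> rf; exact: (recursive_apply1 pr_succ rf). Qed.

Lemma recursive_const c : recursive (fun=> c).
Proof.
by elim: c => [n|c IH]; [exact: pr_zero|exact: recursive_succ].
Qed.

(** The argument order of [pr_rec] fixes the convention: in [h] the counter is variable 0, the value
    so far is variable 1, and the environment is shifted by two. The recursion argument is finally
    replaced by [k x]. *)
Lemma recursive_iteri k g h : recursive k -> recursive g -> recursive h ->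
  recursive (fun x => iteri (k x) (fun i y => h [:: i, y & x]) (g x)).
Proof.
move=> rk rg rh n.
pose F (x : n.+1.-tuple nat) :=
  iteri (thead x) (fun i y => h [:: i, y & behead x]) (g (behead x)).
have rF : total_recursive F.
  apply: (pr_rec (rg n) (rh n.+2)) => [x|i x]; first by rewrite /F theadE.
  by rewrite /F /= !theadE.
pose H (i : 'I_n.+1) (x : n.-tuple nat) : nat :=
  if unlift ord0 i is Some j then tnth x j else k x.
have rH i : total_recursive (H i).
  by rewrite /H; case: unlift => [j|]; [exact: pr_proj|exact: rk].
have := total_recursive_comp rF rH.
congr partial_recursive; apply/funext => x; congr Some.
have -> : [tuple H i x | i < n.+1] = cons_tuple (k x) x.
  apply: eq_from_tnth => i; rewrite tnth_mktuple /H.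
  by case: unliftP => [j ->|->]; rewrite ?tnthS ?tnth0.
by rewrite /F theadE.
Qed.

Lemma recursive_add f g : recursive f -> recursive g ->
  recursive (fun x => f x + g x)%N.
Proof.
move=> rf rg; have := recursive_iteri rf rg (recursive_succ (recursive_var 1)).
congr recursive; apply/funext => x /=.
by elim: (f x) => //= n ->.
Qed.

(* Inserting a dummy variable at position 1 of the environment. *)
Lemma recursive_weaken h : recursive h ->
  recursive (fun x => h (nth 0%N x 0 :: drop 2 x)).
Proof.
move=> rh n.
pose e (i : 'I_(n - 2).+1) x := nth 0%N x (if val i is j.+1 then j.+2 else 0%N).
have := recursive_subst rh (h := e) (fun i => recursive_var _) n.
congr partial_recursive; apply/funext => x; congr (Some (h _)).
rewrite /image_mem enum_ordSl /=; congr (_ :: _); rewrite -map_comp.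
apply: (@eq_from_nth _ 0%N) => [|i].
  by rewrite size_map size_drop size_enum_ord size_tuple.
rewrite size_map size_enum_ord => ilt; rewrite (nth_map (Ordinal ilt)) ?size_enum_ord//.
by rewrite nth_drop /e /= nth_enum_ord.
Qed.

Lemma recursive_sum f h : recursive f -> recursive h ->
  recursive (fun x => \sum_(i < f x) h (nat_of_ord i :: x))%N.
Proof.
move=> rf rh.
(* The loop body sees the accumulator at position 1 while the summand does not, hence the
   weakening. *)
have := recursive_iteri rf (recursive_const 0)
  (recursive_add (recursive_var 1) (recursive_weaken rh)).
congr recursive; apply/funext => x /=.
by elim: (f x) => [|n IH] /=; rewrite ?big_ord0// big_ord_recr /= IH drop0.
Qed.

Lemma recursive_mul f g : recursive f -> recursive g ->
  recursive (fun x => f x * g x)%N.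
Proof.
move=> rf rg.
(* Two variables are treated first and [f], [g] substituted afterwards, so that neither has to be
   shifted under a binder. *)
suff r2 : recursive (fun x => nth 0%N x 0 * nth 0%N x 1)%N.
  exact: (recursive_subst2 r2 rf rg).
(* Under the summation index, variable 2 is the outer variable 1, so all summands are equal. *)
have := recursive_sum (recursive_var 0) (recursive_var 2).
by congr recursive; apply/funext => x; rewrite /= sum_nat_const card_ord.
Qed.

Lemma recursive_prod f h : recursive f -> recursive h ->
  recursive (fun x => \prod_(i < f x) h (nat_of_ord i :: x))%N.
Proof.
move=> rf rh.
have := recursive_iteri rf (recursive_const 1)
  (recursive_mul (recursive_var 1) (recursive_weaken rh)).
congr recursive; apply/funext => x /=.
by elim: (f x) => [|n IH] /=; rewrite ?big_ord0// big_ord_recr /= IH drop0.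
Qed.

Lemma recursive_exp f g : recursive f -> recursive g ->
  recursive (fun x => f x ^ g x)%N.
Proof.
move=> rf rg.
suff r2 : recursive (fun x => nth 0%N x 0 ^ nth 0%N x 1)%N.
  exact: (recursive_subst2 r2 rf rg).
have := recursive_iteri (recursive_var 1) (recursive_const 1)
  (recursive_mul (recursive_var 2) (recursive_var 1)).
congr recursive; apply/funext => x /=.
by elim: (nth _ x 1) => //= n ->; rewrite expnS.
Qed.

Lemma recursive_pred f : recursive f -> recursive (fun x => (f x).-1).
Proof.
move=> rf; have := recursive_iteri rf (recursive_const 0) (recursive_var 0).
by congr recursive; apply/funext => x /=; case: (f x).
Qed.

Lemma recursive_sub f g : recursive f -> recursive g ->
  recursive (fun x => f x - g x)%N.
Proof.
move=> rf rg; have := recursive_iteri rg rf (recursive_pred (recursive_var 1)).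
congr recursive; apply/funext => x /=.
by elim: (g x) => [|n IH] /=; rewrite ?subn0// IH subnS.
Qed.

Lemma recursive_leq f g : recursive f -> recursive g ->
  recursive (fun x => f x <= g x)%N.
Proof.
move=> rf rg; have := recursive_sub (recursive_const 1) (recursive_sub rf rg).
by congr recursive; apply/funext => x; rewrite -subn_eq0; case: (f x - g x)%N.
Qed.

Lemma recursive_not (b : seq nat -> bool) : recursive b ->
  recursive (fun x => ~~ b x).
Proof.
move=> rb; have := recursive_sub (recursive_const 1) rb.
by congr recursive; apply/funext => x; case: (b x).
Qed.

Lemma recursive_and (b c : seq nat -> bool) : recursive b -> recursive c ->
  recursive (fun x => b x && c x).
Proof.
move=> rb rc; have := recursive_mul rb rc.
by congr recursive; apply/funext => x; case: (b x); case: (c x).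
Qed.

Lemma recursive_eq f g : recursive f -> recursive g ->
  recursive (fun x => f x == g x).
Proof.
move=> rf rg; have := recursive_and (recursive_leq rf rg) (recursive_leq rg rf).
by congr recursive; apply/funext => x; rewrite eqn_leq.
Qed.

Lemma recursive_if (b : seq nat -> bool) f g :
  recursive b -> recursive f -> recursive g ->
  recursive (fun x => if b x then f x else g x).
Proof.
move=> rb rf rg; have := recursive_add (recursive_mul rb rf)
  (recursive_mul (recursive_not rb) rg).
by congr recursive; apply/funext => x; case: (b x); rewrite ?mul1n ?mul0n ?addn0.
Qed.

Lemma recursive_min f g : recursive f -> recursive g ->
  recursive (fun x => minn (f x) (g x)).
Proof.
move=> rf rg; apply: recursive_if => //.
by apply: recursive_leq => //; exact: recursive_succ.
Qed.

(** Bounded counting: quotients, 2-adic valuations and lengths of coded lists are all obtained below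
    as the number of [i] in a range that satisfy a downward closed condition. *)
Lemma sum_ltn m n : (\sum_(i < m) (i < n) = minn m n)%N.
Proof.
elim: m => [|m IH]; first by rewrite big_ord0 min0n.
by rewrite big_ord_recr /= IH; lia.
Qed.

(** [m %/ d] is the number of [i < m] with [i.+1 * d <= m]; the factor testing [1 <= d] gives the
    value 0 for a zero divisor. *)
Lemma recursive_div f g : recursive f -> recursive g ->
  recursive (fun x => f x %/ g x)%N.
Proof.
move=> rf rg.
suff r2 : recursive (fun x => nth 0 x 0 %/ nth 0 x 1)%N.
  exact: (recursive_subst2 r2 rf rg).
have := recursive_mul (recursive_leq (recursive_const 1) (recursive_var 1))
  (recursive_sum (recursive_var 0) (recursive_leq
    (recursive_mul (recursive_succ (recursive_var 0)) (recursive_var 2))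
    (recursive_var 1))).
congr recursive; apply/funext => x /=.
set m := nth _ x 0; set d := nth _ x 1.
have [->|d0] := posnP d; first by rewrite divn0.
rewrite mul1n (eq_bigr (fun i : 'I_m => nat_of_bool (i < m %/ d)%N)); last first.
  by move=> i _; rewrite leq_divRL.
by rewrite sum_ltn (minn_idPr _) ?leq_div.
Qed.

Lemma recursive_mod f g : recursive f -> recursive g ->
  recursive (fun x => f x %% g x)%N.
Proof.
move=> rf rg; have := recursive_sub rf (recursive_mul (recursive_div rf rg) rg).
congr recursive; apply/funext => x.
by rewrite {1}(divn_eq (f x) (g x)) addKn.
Qed.

(** * Codes of strings *)

(** A search whose body ignores the searched variable stops at 0 when [b] holds and never stops
    otherwise. *)
Lemma re_set_recursive (b : seq nat -> bool) n : recursive b ->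
  re_set [set x : n.-tuple nat | b x].
Proof.
move=> rb; exists (fun x : n.-tuple nat => if b x then Some 0%N else None); last first.
  by move=> x /=; case: (b x).
pose g (x : n.+1.-tuple nat) := Some (nat_of_bool (~~ b (behead x))).
apply: (@pr_mu _ g).
  have := total_recursive_comp (h := fun i x => tnth x (lift ord0 i))
    (recursive_not rb n) (fun i => pr_proj _).
  congr partial_recursive; apply/funext => x; congr (Some (nat_of_bool (~~ b _))).
  rewrite -[behead x]/(tval (behead_tuple x)); congr tval.
  apply: eq_from_tnth => i; rewrite tnth_mktuple tnth_behead.
  by congr (tnth x); apply: val_inj; rewrite /= inordK ?ltnS.
move=> x y; rewrite /g /=; case: (b x) => /=.
  split=> [[<-]//|[_]]; case: y => [//|y /(_ 0%N isT)[v]//].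
by split=> // -[].
Qed.

(* [CodeSeq.code (n :: s)] is [2 ^ n * (2 * CodeSeq.code s + 1)]. *)
Definition code_head (c : nat) : nat := (\sum_(e < c) (2 ^ e.+1 %| c))%N.

Definition code_behead (c : nat) : nat := (c %/ 2 ^ (code_head c).+1)%N.

Definition code_nth (c i : nat) : nat := code_head (iter i code_behead c).

(** The code of the empty list is 0, so the positive iterates are the nonempty suffixes; [c] is a
    sufficient bound because a list is no longer than its code. *)
Definition code_size (c : nat) : nat := (\sum_(i < c) (0 < iter i code_behead c))%N.

Definition code_count (r c : nat) : nat :=
  (\sum_(i < code_size c) (code_nth c i == r))%N.

Lemma code_cons n s :
  CodeSeq.code (n :: s) = (2 ^ n * (CodeSeq.code s).*2.+1)%N.
Proof. by []. Qed.

(** The cofactor of [2 ^ n] in the code is odd, so [2 ^ e.+1] divides the code exactly for [e < n];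
    and [n] does not exceed the code, so the bounded sum misses none of these. *)
Lemma code_head_cons n s : code_head (CodeSeq.code (n :: s)) = n.
Proof.
rewrite /code_head; set c := CodeSeq.code _.
rewrite (eq_bigr (fun i : 'I_c => nat_of_bool (i < n)%N)) => [|[i /= _] _]; last first.
  rewrite /c code_cons; set v := CodeSeq.code s.
  have [lt|le] := ltnP i n; first by rewrite dvdn_mulr ?dvdn_exp2l.
  rewrite -(subnKC le) -addnS expnD dvdn_pmul2l ?expn_gt0// expnS.
  congr nat_of_bool; apply/negbTE/negP => /dvdnP[q].
  by move=> /(congr1 odd); rewrite /= odd_double mulnCA oddM.
rewrite sum_ltn (minn_idPr _)// /c code_cons.
by rewrite (leq_trans (ltnW (ltn_expl n (isT : (1 < 2)%N))))// leq_pmulr.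
Qed.

Lemma code_behead_cons n s :
  code_behead (CodeSeq.code (n :: s)) = CodeSeq.code s.
Proof.
rewrite /code_behead code_head_cons code_cons expnS mulnC [(2 * _)%N]mulnC.
by rewrite [(_ * 2 ^ n)%N]mulnC divnMl ?expn_gt0// divn2 /= uphalf_double.
Qed.

Lemma iter_code_behead i s :
  iter i code_behead (CodeSeq.code s) = CodeSeq.code (drop i s).
Proof.
elim: i s => [|i IH] s; first by rewrite drop0.
rewrite iterSr; case: s => [|n s]; last by rewrite code_behead_cons IH.
(* The code 0 of the empty list is a fixed point, so iterating past the end is harmless. *)
have -> : code_behead (CodeSeq.code [::]) = CodeSeq.code [::].
  by rewrite /code_behead div0n.
by rewrite IH; case: i {IH}.
Qed.

Lemma code_nthE s i : code_nth (CodeSeq.code s) i = nth 0%N s i.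
Proof.
rewrite /code_nth iter_code_behead -[i in RHS]addn0 -nth_drop.
case: (drop i s) => [|n t]; last by rewrite code_head_cons.
by rewrite /code_head big_ord0.
Qed.

Lemma code_gt0 s : (0 < CodeSeq.code s)%N = (0 < size s)%N.
Proof. by case: s => // n s; rewrite code_cons muln_gt0 expn_gt0. Qed.

Lemma size_le_code s : (size s <= CodeSeq.code s)%N.
Proof.
elim: s => // n s IH; rewrite code_cons /=.
apply: (leq_trans (n := (CodeSeq.code s).*2.+1)); last by rewrite leq_pmull ?expn_gt0.
by rewrite ltnS (leq_trans IH)// -addnn leq_addr.
Qed.

Lemma code_sizeE s : code_size (CodeSeq.code s) = size s.
Proof.
rewrite /code_size (eq_bigr (fun i : 'I__ => nat_of_bool (i < size s)%N)).
  by rewrite sum_ltn (minn_idPr _)// size_le_code.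
by move=> i _; rewrite iter_code_behead code_gt0 size_drop subn_gt0.
Qed.

Lemma sum_nth_count (p : pred nat) s :
  (\sum_(i < size s) p (nth 0 s i) = count p s)%N.
Proof.
by elim: s => [|n s IH] /=; rewrite ?big_ord0// big_ord_recl /= -IH.
Qed.

Lemma code_countE r s : code_count r (CodeSeq.code s) = count_mem r s.
Proof.
rewrite /code_count code_sizeE -(sum_nth_count (pred1 r)).
by apply: eq_bigr => i _; rewrite code_nthE.
Qed.

Lemma recursive_code_head f : recursive f -> recursive (fun x => code_head (f x)).
Proof.
move=> rf; apply: (recursive_subst1 (g := fun x => code_head (nth 0%N x 0))) rf.
have := recursive_sum (recursive_var 0) (recursive_eq
  (recursive_mod (recursive_var 1)
     (recursive_exp (recursive_const 2) (recursive_succ (recursive_var 0))))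
  (recursive_const 0)).
by congr recursive.
Qed.

Lemma recursive_code_behead f :
  recursive f -> recursive (fun x => code_behead (f x)).
Proof.
move=> rf; apply: recursive_div => //; apply: recursive_exp.
  exact: recursive_const.
exact: recursive_succ (recursive_code_head rf).
Qed.

Lemma recursive_iter_code_behead f g : recursive f -> recursive g ->
  recursive (fun x => iter (f x) code_behead (g x)).
Proof.
move=> rf rg; have := recursive_iteri rf rg (recursive_code_behead (recursive_var 1)).
by congr recursive; apply/funext => x /=; elim: (f x) => //= n ->.
Qed.

Lemma recursive_code_nth f g : recursive f -> recursive g ->
  recursive (fun x => code_nth (f x) (g x)).
Proof.
by move=> rf rg; apply: recursive_code_head; exact: recursive_iter_code_behead.
Qed.

Lemma recursive_code_size f : recursive f -> recursive (fun x => code_size (f x)).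
Proof.
move=> rf; apply: (recursive_subst1 (g := fun x => code_size (nth 0%N x 0))) rf.
exact: recursive_sum (recursive_var 0) (recursive_leq (recursive_const 1)
  (recursive_iter_code_behead (recursive_var 0) (recursive_var 1))).
Qed.

Lemma recursive_code_count r f :
  recursive f -> recursive (fun x => code_count r (f x)).
Proof.
move=> rf; apply: (recursive_subst1 (g := fun x => code_count r (nth 0%N x 0))) rf.
exact: recursive_sum (recursive_code_size (recursive_var 0)) (recursive_eq
  (recursive_code_nth (recursive_var 1) (recursive_var 0)) (recursive_const r)).
Qed.

(** * Expectations over words and the Bernoulli measure *)

(** The expectation of [F] at a random word of [L] independent letters with weights [w], by
    conditioning on the first letter. The weights are a bare function so that images of [P] and
    rational approximations can be substituted. *)
Fixpoint expect (R : realType) (T : finType) (w : T -> R) (L : nat)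
    (F : seq T -> R) : R :=
  if L is L'.+1 then \sum_a w a * expect w L' (fun s => F (a :: s)) else F [::].

Lemma eq_expect (R : realType) (T : finType) (w : T -> R) L (F G : seq T -> R) :
  (forall s, size s = L -> F s = G s) -> expect w L F = expect w L G.
Proof.
elim: L F G => [|L IH] F G FG /=; first exact: FG.
by apply: eq_bigr => a _; congr (_ * _); apply: IH => s sL; apply: FG; rewrite /= sL.
Qed.

Lemma expectD (R : realType) (T : finType) (w : T -> R) L (F G : seq T -> R) :
  expect w L (fun s => F s + G s) = expect w L F + expect w L G.
Proof.
elim: L F G => [//|L IH] F G /=.
by rewrite -big_split; apply: eq_bigr => a _; rewrite IH mulrDr.
Qed.

Lemma expectZ (R : realType) (T : finType) (w : T -> R) L c (F : seq T -> R) :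
  expect w L (fun s => c * F s) = c * expect w L F.
Proof.
elim: L F => [//|L IH] F /=.
by rewrite mulr_sumr; apply: eq_bigr => a _; rewrite IH mulrCA.
Qed.

Lemma le_expect (R : realType) (T : finType) (w : T -> R) L (F G : seq T -> R) :
  (forall a, 0 <= w a) -> (forall s, size s = L -> F s <= G s) ->
  expect w L F <= expect w L G.
Proof.
move=> w0; elim: L F G => [|L IH] F G FG /=; first exact: FG.
apply: ler_sum => a _; apply: ler_wpM2l => //; apply: IH => s sL.
by apply: FG; rewrite /= sL.
Qed.

(** Independence of the letters; it evaluates the moment generating function in Chernoff's bound. *)
Lemma expect_prod (R : realType) (T : finType) (w g : T -> R) L :
  expect w L (fun s => \prod_(a <- s) g a) = (\sum_a w a * g a) ^+ L.
Proof.
elim: L => [|L IH] /=; first by rewrite big_nil.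
rewrite exprS mulr_suml; apply: eq_bigr => a _.
rewrite -mulrA; congr (_ * _); rewrite -IH -expectZ.
by apply: eq_expect => s _; rewrite big_cons.
Qed.

Lemma expect_cst (R : realType) (T : finType) (w : T -> R) L c :
  \sum_a w a = 1 -> expect w L (fun=> c) = c.
Proof.
by move=> w1; elim: L => //= L ->; rewrite -mulr_suml w1 mul1r.
Qed.

(** Pushing the weights forward along [h]; with [h] the indicator of a letter this reduces an
    arbitrary alphabet to coin tossing. *)
Lemma expect_map (R : realType) (T U : finType) (h : T -> U) (w : T -> R) L
    (G : seq U -> R) :
  expect w L (fun s => G (map h s)) =
  expect (fun u => \sum_(a | h a == u) w a) L G.
Proof.
elim: L G => [//|L IH] G /=.
rewrite (partition_big h predT)//=; apply: eq_bigr => u _.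
rewrite mulr_suml; apply: eq_bigr => a /eqP <-.
by rewrite (IH (fun s => G (h a :: s))).
Qed.

(** The weights are exchanged one letter at a time. Each exchange costs at most [d], since the
    remaining expectation lies in the unit interval. *)
Lemma expect_close (R : realType) (T : finType) (v w : T -> R) L
    (G : seq T -> R) (d : R) :
  (forall a, 0 <= v a) -> \sum_a v a = 1 ->
  (forall a, 0 <= w a) -> \sum_a w a = 1 ->
  \sum_a `|v a - w a| <= d -> (forall s, 0 <= G s <= 1) ->
  `|expect v L G - expect w L G| <= L%:R * d.
Proof.
move=> v0 v1 w0 w1 vw; elim: L G => [|L IH] G G01 /=.
  by rewrite subrr normr0 mul0r.
have E01 a : `|expect v L (fun s => G (a :: s))| <= 1.
  rewrite ger0_norm.
    rewrite -[leRHS](expect_cst L 1 v1); apply: le_expect => // s _.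
    by case/andP: (G01 (a :: s)).
  rewrite -[leLHS](expect_cst L 0 v1); apply: le_expect => // s _.
  by case/andP: (G01 (a :: s)).
(* The difference of products is split into a change of the first weight and a change in the
   remaining letters; the induction hypothesis handles the latter. *)
rewrite -sumrB (eq_bigr (fun a =>
    (v a - w a) * expect v L (fun s => G (a :: s)) +
    w a * (expect v L (fun s => G (a :: s)) -
           expect w L (fun s => G (a :: s))))); last first.
  by move=> a _; rewrite mulrBr mulrBl addrA subrK.
rewrite big_split/= mulrS mulrDl mul1r (le_trans (ler_normD _ _))// lerD//.
  rewrite (le_trans _ vw)// (le_trans (ler_norm_sum _ _ _))//.
  by apply: ler_sum => a _; rewrite normrM ler_piMr.
rewrite (le_trans (ler_norm_sum _ _ _))// -[leRHS]mul1r -[X in X * _]w1 mulr_suml.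
apply: ler_sum => a _; rewrite normrM ger0_norm//; apply: ler_wpM2l => //.
exact: IH.
Qed.

(** * Binary words as integers *)

Definition bit (v i : nat) : bool := odd (v %/ 2 ^ i).

Lemma bit0 (b : bool) v : bit (b + v.*2) 0 = b.
Proof. by rewrite /bit divn1 oddD odd_double addbF; case: b. Qed.

Lemma bitS (b : bool) v i : bit (b + v.*2) i.+1 = bit v i.
Proof.
by rewrite /bit expnS divnMA divn2 half_bit_double.
Qed.

Lemma sum_double (R : realType) n (F : nat -> R) :
  \sum_(i < n.*2) F i = \sum_(i < n) \sum_(b : bool) F (b + i.*2)%N.
Proof.
elim: n => [|n IH]; first by rewrite !big_ord0.
by rewrite doubleS !big_ord_recr/= IH big_bool /= -addrA [X in _ + X]addrC.
Qed.

(** The words of length [L] are the digit sequences, least significant digit first, of the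
    [v < 2 ^ L]. This turns an expectation into an arithmetical sum that a recursive function can
    evaluate. *)
Lemma expect_bits (R : realType) (w : bool -> R) L (G : seq bool -> R) :
  expect w L G = \sum_(v < 2 ^ L) \prod_(i < L) w (bit v i) * G (mkseq (bit v) L).
Proof.
elim: L G => [|L IH] G.
  by rewrite expn0 big_ord1 big_ord0 mul1r.
rewrite expnS mul2n (sum_double _ (fun v =>
  \prod_(i < L.+1) w (bit v i) * G (mkseq (bit v) L.+1))).
rewrite exchange_big /=; apply: eq_bigr => b _.
rewrite IH mulr_sumr; apply: eq_bigr => v _.
rewrite big_ord_recl /= mulrA bit0; congr (_ * _ * G _).
  by apply: eq_bigr => i _; rewrite bitS.
rewrite /mkseq /= bit0 (iotaDl 1) -map_comp; congr (_ :: _).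
by apply: eq_map => i; rewrite /= bitS.
Qed.

(** * Events determined by finitely many letters *)

Lemma measurable_prefix_set (Omega : alphabetType) (S : set (seq Omega)) :
  measurable (prefix_set S : set (iseq Omega)).
Proof. by apply: sub_sigma_algebra; exists S. Qed.

Lemma mkseq_prefix_set (Omega : alphabetType) L (Q : set (seq Omega)) :
  [set beta : iseq Omega | Q (mkseq beta L)] =
  prefix_set [set s | size s = L /\ Q s].
Proof.
apply/seteqP; split=> [beta Qb|beta [n] /= []].
  by exists L; rewrite /= size_mkseq.
by rewrite size_mkseq => ->.
Qed.

Lemma measurable_mkseq (Omega : alphabetType) L (Q : set (seq Omega)) :
  measurable [set beta : iseq Omega | Q (mkseq beta L)].
Proof. by rewrite mkseq_prefix_set; exact: measurable_prefix_set. Qed.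

Lemma take_mkseq (T : Type) (f : nat -> T) n m :
  (n <= m)%N -> take n (mkseq f m) = mkseq f n.
Proof. by move=> nm; rewrite /mkseq -map_take take_iota (minn_idPl nm). Qed.

(** Induction on [L] for all [s] at once: the event splits according to the letter that follows [s],
    which reproduces the recursion defining [expect]. *)
Lemma bernoulli_cylinder_expect (R : realType) (Omega : alphabetType)
    (P : finProbSpace R Omega) L (Q : pred (seq Omega)) s :
  bernoulli_measure P
    [set beta | mkseq beta (size s) = s /\ Q (mkseq beta (size s + L))] =
  (\prod_(a <- s) P a * expect P L (fun u => (Q (s ++ u))%:R))%:E.
Proof.
elim: L s => [|L IH] s /=.
  rewrite addn0 cats0; have [Qs|Qs] := boolP (Q s).
    rewrite mulr1 -(bernoulli_measureE P); congr (bernoulli_measure P _).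
    rewrite [RHS](_ : _ = [set beta | [set s] (mkseq beta (size s))]).
      by apply/seteqP; split=> beta /=; [case|move=> ->].
    rewrite mkseq_prefix_set; congr prefix_set.
    by apply/seteqP; split => [_ ->|u []].
  rewrite mulr0 (_ : [set _ | _] = set0) ?measure0//.
  by apply/seteqP; split=> // beta /= [->]; apply/negP.
pose A a := [set beta : iseq Omega | mkseq beta (size (rcons s a)) = rcons s a /\
  Q (mkseq beta (size (rcons s a) + L))].
rewrite (_ : [set _ | _] = \bigcup_(a in setT) A a); last first.
  apply/seteqP; split=> [beta /= [bs Qb]|beta [a _] []].
    exists (beta (size s)) => //; split; rewrite size_rcons ?addSnnS//.
    by rewrite mkseqS bs.
  by rewrite size_rcons addSnnS mkseqS => /rcons_inj[].
rewrite measure_fin_bigcup//=; last 2 first.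
  apply/trivIsetP => a b _ _ ab; apply/seteqP; split=> // beta [[+ _] [+ _]].
  by rewrite !size_rcons => -> /rcons_inj[] /eqP; rewrite (negbTE ab).
  move=> a _; pose S := [set u : seq Omega |
    take (size (rcons s a)) u = rcons s a /\ Q u].
  rewrite (_ : A a = [set beta : iseq Omega | S (mkseq beta (size (rcons s a) + L))]).
    exact: measurable_mkseq.
  by apply/seteqP; split=> beta; rewrite /S /A /= take_mkseq// leq_addr.
rewrite (fsbigE (index_enum Omega)) ?index_enum_uniq//; last first.
  by move=> a _; rewrite mem_index_enum.
rewrite (eq_bigl xpredT) => [|a]; last by rewrite in_setT.
rewrite mulr_sumr -sumEFin; apply: eq_bigr => a _; rewrite IH.
rewrite big_rcons /= mulrA; congr (_ * _)%:E; apply: eq_expect => u _.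
by rewrite cat_rcons.
Qed.

Lemma bernoulli_expect (R : realType) (Omega : alphabetType)
    (P : finProbSpace R Omega) L (Q : pred (seq Omega)) :
  bernoulli_measure P [set beta | Q (mkseq beta L)] =
  (expect P L (fun u => (Q u)%:R))%:E.
Proof.
have := bernoulli_cylinder_expect P L Q [::]; rewrite big_nil mul1r => <-.
by congr (bernoulli_measure P _); apply/seteqP; split=> beta /= => [|[]].
Qed.

(** * Large deviations *)

(** From [1 - x <= expR (- x)] one gets [(1 - x) * expR x <= 1], while
    [(1 - x) * (1 + x + 2 * x ^+ 2)] equals [1 + x ^+ 2 * (1 - 2 * x)], which is at least 1. *)
Lemma expR_le_quadratic (R : realType) (x : R) :
  `|x| <= 2^-1 -> expR x <= 1 + x + 2 * x ^+ 2.
Proof.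
rewrite ler_norml => /andP[x1 x2].
have := expR_ge1Dx (- x); rewrite expRN => h.
have e0 := expR_gt0 x.
have : (1 - x) * expR x <= 1 by rewrite -ler_pdivlMr// mul1r.
have : 0 <= x ^+ 2 * (1 - 2 * x) by rewrite mulr_ge0 ?sqr_ge0//; lra.
have x3 : 0 < 1 - x by lra.
move=> h1 h2; rewrite -(ler_pM2l x3) (le_trans h2)//; nra.
Qed.

(** [expR x] is the [j]-th power of [expR (x / j)], which exceeds [x / j]. This trades exponential
    decay for the polynomial decay of the tail bound. *)
Lemma expR_ge_pow (R : realType) (x : R) j : (0 < j)%N -> 0 <= x ->
  (x / j%:R) ^+ j <= expR x.
Proof.
move=> j0 x0; have jR : j%:R != 0 :> R by rewrite pnatr_eq0 -lt0n.
rewrite -[x in leRHS](divfK jR) expRM_natr.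
rewrite lerXn2r ?nnegrE ?expR_ge0 ?divr_ge0//.
by rewrite (le_trans _ (expR_ge1Dx _))// lerDr.
Qed.

Definition bern (R : realType) (p : R) (b : bool) : R := if b then p else 1 - p.

Lemma prod_expR_dev (R : realType) (p u : R) (s : seq bool) :
  \prod_(b <- s) expR (u * (b%:R - p)) =
  expR (u * ((count id s)%:R - (size s)%:R * p)).
Proof.
elim: s => [|b s IH]; first by rewrite big_nil mul0r subr0 mulr0 expR0.
rewrite big_cons IH -expRD; congr expR => /=.
by rewrite natrD mulrS; ring.
Qed.

(** The expectation is a [k]-th power. In one factor the linear terms cancel because the letter is
    centred, leaving at most [1 + 2 * u ^+ 2 * (p * (1 - p))], hence at most [expR (2 * u ^+ 2)]. *)
Lemma expect_expR_dev (R : realType) (p u : R) k :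
  0 <= p <= 1 -> `|u| <= 2^-1 ->
  expect (bern p) k (fun s => expR (u * ((count id s)%:R - k%:R * p))) <=
  expR (2 * u ^+ 2 * k%:R).
Proof.
move=> /andP[p0 p1] u1; rewrite (eq_expect _
    (G := fun s : seq bool => \prod_(b <- s) expR (u * (b%:R - p)))) => [|s <-];
  last by rewrite prod_expR_dev.
rewrite expect_prod expRM_natr lerXn2r ?nnegrE ?expR_ge0//.
  by rewrite big_bool addr_ge0// mulr_ge0 ?expR_ge0//= subr_ge0.
rewrite (le_trans _ (expR_ge1Dx _))// big_bool /= sub0r.
have u2 : u ^+ 2 <= 4^-1 by rewrite -real_normK ?num_real//; have := normr_ge0 u; nra.
have [h1 h2] : `|u * (1 - p)| <= 2^-1 /\ `|u * - p| <= 2^-1.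
  have := normr_ge0 u; rewrite !normrM normrN (ger0_norm p0).
  by rewrite (@ger0_norm _ (1 - p)) ?subr_ge0//; split; nra.
have := expR_le_quadratic h1; have := expR_le_quadratic h2.
set e1 := expR (u * - p); set e2 := expR (u * (1 - p)).
rewrite !exprMn sqrrN => h3 h4.
have h5 : p * e2 <= p * (1 + u * (1 - p) + 2 * (u ^+ 2 * (1 - p) ^+ 2)).
  by rewrite ler_wpM2l.
have h6 : (1 - p) * e1 <= (1 - p) * (1 + u * - p + 2 * (u ^+ 2 * p ^+ 2)).
  by rewrite ler_wpM2l// subr_ge0.
rewrite (le_trans (lerD h5 h6))//.
rewrite [leLHS](_ : _ = 1 + 2 * u ^+ 2 * (p * (1 - p))); last by ring.
rewrite lerD2l ler_piMr// ?(mulr_ge0 (ler0n _ 2) (sqr_ge0 u))//.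
by rewrite mulr_ile1 ?subr_ge0// gerBl.
Qed.

(** The 2 counts the two tails, [(2 * m) ^ (2 * m)] comes from [expR_ge_pow] with exponent [2 * m],
    and [64 ^ m] from the power of [x] in [tail_dev]. *)
Definition tail_cst (m : nat) : nat := (2 * (64 ^ m * (2 * m) ^ (2 * m)))%N.

Lemma tail_cst_gt0 m : (0 < m)%N -> (0 < tail_cst m)%N.
Proof. by move=> m0; rewrite !muln_gt0 !expn_gt0 muln_gt0 m0. Qed.

(* Exponential Markov inequality at the rate [u = t / (4 k)], where
   [t = k ^ ((m + 1) / (2 m))], gives [2 exp (- x)] with [x = t ^ 2 / (8 k)];
   since [x ^ (2 m) = k ^ 2 / 64 ^ m], this is at most [tail_cst m / k ^ 2]. *)
Lemma tail_dev (R : realType) (p : R) m k :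
  0 <= p <= 1 -> (0 < m)%N -> (0 < k)%N ->
  expect (bern p) k (fun s =>
    (k%:R ^+ m.+1 <= `|(count id s)%:R - k%:R * p| ^+ (2 * m))%R%:R) <=
  (tail_cst m)%:R / k%:R ^+ 2.
Proof.
move=> p01 m0 k0.
have k1 : 1 <= k%:R :> R by rewrite ler1n.
have kR : 0 < k%:R :> R by rewrite ltr0n.
have mR : 0 < m%:R :> R by rewrite ltr0n.
pose t : R := k%:R `^ (m.+1%:R / (2 * m)%:R).
have t0 : 0 < t by rewrite powR_gt0.
have tm : t ^+ (2 * m) = k%:R ^+ m.+1.
  by rewrite -!powR_mulrn ?powR_ge0// -powRrM divfK// pnatr_eq0 muln_eq0 -!lt0n.
have tk : t <= k%:R.
  rewrite ler1_powR// ler_pdivrMr ?ltr0n ?muln_gt0//= mul1r ler_nat; lia.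
pose u : R := t / (4 * k%:R).
have u0 : 0 < u by rewrite divr_gt0// mulr_gt0.
have u1 : u <= 2^-1 by rewrite ler_pdivrMr ?mulr_gt0//; lra.
pose x : R := t ^+ 2 / (8 * k%:R).
have x0 : 0 < x by rewrite divr_gt0 ?exprn_gt0 ?mulr_gt0.
have xm : x ^+ (2 * m) = k%:R ^+ 2 / 64 ^+ m.
  have -> : x ^+ (2 * m) = (x ^+ m) ^+ 2 by rewrite -exprM mulnC.
  have -> : x ^+ m = k%:R / 8 ^+ m.
    rewrite /x expr_div_n -exprM tm exprMn exprS; field.
    by rewrite !expf_neq0 ?gt_eqF.
  by rewrite expr_div_n -exprM mulnC exprM; congr (_ / _ ^+ _); ring.
(* The chosen rate is the one minimising this exponent in [u]. *)
have xE : 2 * u ^+ 2 * k%:R - u * t = - x.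
  by rewrite /u /x; field; rewrite gt_eqF.
rewrite (le_trans (y := 2 * expR (- x)))//; last first.
  rewrite /tail_cst natrM -mulrA ler_wpM2l// expRN.
  rewrite -[leRHS]invrK lef_pV2 ?posrE ?expR_gt0//; last first.
    by rewrite invr_gt0 divr_gt0 ?exprn_gt0 ?ltr0n ?muln_gt0 ?expn_gt0 ?muln_gt0 ?m0.
  rewrite (le_trans _ (expR_ge_pow (_ : 0 < 2 * m)%N (ltW x0))) ?muln_gt0//.
  rewrite expr_div_n xm invf_div natrM invfM mulrA natrX !natrX//.
(* One pointwise bound serves both signs: on the event, one of the two exponentials is at least
   [expR (u * t)]. *)
have bound s : size s = k ->
    ((k%:R ^+ m.+1 <= `|(count id s)%:R - k%:R * p| ^+ (2 * m))%R%:R : R) <=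
    expR (- (u * t)) * (expR (u * ((count id s)%:R - k%:R * p)) +
                        expR (- u * ((count id s)%:R - k%:R * p))).
  move=> _; set y := _ - k%:R * p; rewrite mulrDr -!expRD.
  have [|_] := boolP (k%:R ^+ m.+1 <= _); last by rewrite addr_ge0 ?expR_ge0.
  rewrite -tm ler_pXn2r ?muln_gt0 ?m0 ?nnegrE ?(ltW t0) ?normr_ge0//.
  rewrite ler_normr => /orP[h|h].
    rewrite -[leLHS]addr0 lerD ?expR_ge0// -[leLHS]expR0 ler_expR; nra.
  rewrite -[leLHS]add0r lerD ?expR_ge0// -[leLHS]expR0 ler_expR; nra.
have b0 b : 0 <= bern p b by case/andP: p01 => p0 p1; case: b => //=; rewrite subr_ge0.
apply: (le_trans (le_expect b0 bound)); rewrite expectZ expectD.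
have := @expect_expR_dev _ p u k p01.
rewrite (ger0_norm (ltW u0)) => /(_ u1) h1.
have := @expect_expR_dev _ p (- u) k p01.
rewrite normrN (ger0_norm (ltW u0)) => /(_ u1) h2.
rewrite (le_trans (y := expR (- (u * t)) * (2 * expR (2 * u ^+ 2 * k%:R))))//.
  rewrite ler_wpM2l ?expR_ge0// [2 * expR _]mulr_natl mulr2n lerD//.
  by rewrite sqrrN in h2.
by rewrite mulrCA -expRD addrC xE.
Qed.

(** * Decidable deviations from a computable probability *)

Lemma computable_unit_interval (R : realType) (x : R) :
  0 <= x <= 1 -> computable_real x ->
  exists u d : nat -> nat,
    [/\ recursive (fun e => u (nth 0%N e 0)), recursive (fun e => d (nth 0%N e 0)),
        forall k, (0 < d k)%N, forall k, (u k <= d k)%N &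
        forall k, `|x - (u k)%:R / (d k)%:R| < 2^-1 ^+ k].
Proof.
move=> /andP[x0 x1] [f [a [b [c [ra rb rc fE]]]] fx].
have rlift g : total_recursive g -> recursive (fun e => g [tuple nth 0%N e 0]).
  by move=> rg; exact: recursive_apply1 rg (recursive_var 0).
(* The approximations are clamped to the unit interval, so that they are themselves probabilities;
   since [x] lies there, clamping does not increase the distance. *)
exists (fun k => minn (a [tuple k] - b [tuple k]) (c [tuple k]).+1),
       (fun k => (c [tuple k]).+1).
split=> //.
- by apply: recursive_min; [apply: recursive_sub|apply: recursive_succ]; exact: rlift.
- by apply: recursive_succ; exact: rlift.
- by move=> k; exact: geq_minr.
move=> k; have := fx k; have := fE [tuple k]; rewrite (tnth_nth 0%N)/= => ->.
rewrite fmorph_div rmorphB /= !ratr_nat.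
set A := a _; set B := b _; set D := (c _).+1.
have D0 : 0 < D%:R :> R by rewrite ltr0n.
apply: le_lt_trans.
have [AB|BA] := leqP A B.
  have -> : minn (A - B) D = 0%N by lia.
  have h : (A%:R - B%:R) / D%:R <= 0 :> R.
    by rewrite pmulr_lle0 ?invr_gt0// subr_le0 ler_nat.
  rewrite mul0r subr0 ger0_norm// ler_normr; apply/orP; left; lra.
rewrite -natrB ?(ltnW BA)//.
have [le|lt] := leqP (A - B) D; first by [].
rewrite divff ?gt_eqF//.
have h : 1 <= (A - B)%:R / D%:R :> R by rewrite ler_pdivlMr// mul1r ler_nat ltnW.
rewrite ler0_norm ?subr_le0// ler_normr; apply/orP; right; lra.
Qed.

(* Decidable form of [k ^ (m + 1) <= (|N - k q| - 1) ^ (2 m)], the difference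
   being truncated at [0], for the rational [q = u k / d k]; the slack [1]
   absorbs the error [k |p - q|]. *)
Definition deviates (m : nat) (u d : nat -> nat) (k N : nat) : bool :=
  (k ^ m.+1 * d k ^ (2 * m) <=
   ((N * d k - k * u k) + (k * u k - N * d k) - d k) ^ (2 * m))%N.

Lemma natr_dist (R : realType) (a b : nat) :
  ((a - b) + (b - a))%:R = `|a%:R - b%:R| :> R.
Proof.
have [ab|ba] := leqP a b.
  rewrite (eqP ab) add0n natrB// ler0_norm ?opprB//.
  by rewrite subr_le0 ler_nat.
rewrite [(b - a)%N](_ : _ = 0%N) ?addn0; last by lia.
rewrite natrB ?(ltnW ba)// ger0_norm// subr_ge0 ler_nat; exact: ltnW.
Qed.

Lemma natr_mul_exp2V_le1 (R : realType) k : k%:R * 2^-1 ^+ k <= 1 :> R.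
Proof.
by rewrite exprVn ler_pdivrMr ?exprn_gt0// mul1r -natrX ler_nat ltnW// ltn_expl.
Qed.

(** The approximation is taken at precision [k] itself, so the error [k * |p - q|] is at most
    [k / 2 ^ k], hence at most 1. *)
Lemma deviates_close (R : realType) (p : R) (u d : nat -> nat) k N :
  (0 < d k)%N -> `|p - (u k)%:R / (d k)%:R| < 2^-1 ^+ k ->
  `| `|N%:R - k%:R * p| -
     ((N * d k - k * u k) + (k * u k - N * d k))%:R / (d k)%:R| <= 1.
Proof.
move=> d0 pu; have dR : 0 < (d k)%:R :> R by rewrite ltr0n.
rewrite natr_dist !natrM -[X in _ / X](ger0_norm (ltW dR)) -normf_div.
rewrite mulrBl mulfK ?gt_eqF// -mulrA.
apply: (le_trans (ler_dist_dist _ _)).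
rewrite [X in `|X|](_ : _ = k%:R * - (p - (u k)%:R / (d k)%:R)); last by ring.
rewrite normrM normrN ger0_norm// (le_trans _ (natr_mul_exp2V_le1 R k))//.
by rewrite ler_wpM2l// ltW.
Qed.

Lemma deviates_ge (R : realType) (p : R) m (u d : nat -> nat) k N :
  (0 < m)%N -> (0 < k)%N ->
  (0 < d k)%N -> `|p - (u k)%:R / (d k)%:R| < 2^-1 ^+ k ->
  deviates m u d k N -> k%:R ^+ m.+1 <= `|N%:R - k%:R * p| ^+ (2 * m) :> R.
Proof.
move=> m0 k0 d0 pu; have := deviates_close N d0 pu; rewrite /deviates.
set D := (_ + (k * u k - _))%N; rewrite ler_norml => /andP[h _] dev.
have dR : 0 < (d k)%:R :> R by rewrite ltr0n.
(* Otherwise the truncated difference is 0, and so is its power, whereas the left side of [deviates]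
   is positive. *)
have Dd : (d k < D)%N.
  rewrite ltnNge; apply/negP => le; move: dev.
  rewrite (eqP (_ : D - d k == 0)%N) ?subn_eq0// exp0n ?muln_gt0//.
  by rewrite leqn0 muln_eq0 !expn_eq0 !eqn0Ngt k0 d0.
have w0 : 0 <= D%:R / (d k)%:R - 1 :> R.
  by rewrite subr_ge0 ler_pdivlMr// mul1r ler_nat ltnW.
apply: (le_trans (y := (D%:R / (d k)%:R - 1) ^+ (2 * m))); last first.
  by rewrite lerXn2r ?nnegrE//; lra.
have -> : D%:R / (d k)%:R - 1 = (D - d k)%:R / (d k)%:R :> R.
  by rewrite natrB ?(ltnW Dd)// mulrBl divff ?gt_eqF.
by rewrite expr_div_n ler_pdivlMr ?exprn_gt0// -!natrX -natrM ler_nat.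
Qed.

(** Of the 2 added to [t], one unit is the slack built into [deviates] and the other is the
    approximation error. *)
Lemma deviates_le (R : realType) (p t : R) m (u d : nat -> nat) k N :
  (0 < d k)%N -> `|p - (u k)%:R / (d k)%:R| < 2^-1 ^+ k ->
  0 <= t -> k%:R ^+ m.+1 <= t ^+ (2 * m) ->
  ~~ deviates m u d k N -> `|N%:R - k%:R * p| <= t + 2.
Proof.
move=> d0 pu t0 kt; apply: contraNT; rewrite -ltNge => lt.
have := deviates_close N d0 pu; rewrite /deviates.
set D := (_ + (k * u k - _))%N; rewrite ler_norml => /andP[_ h].
have dR : 0 < (d k)%:R :> R by rewrite ltr0n.
have h1 : t + 1 <= D%:R / (d k)%:R by lra.
have h2 : t * (d k)%:R <= D%:R - (d k)%:R.
  by move: h1; rewrite ler_pdivlMr// mulrDl mul1r lerBrDr.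
have Dd : (d k <= D)%N.
  by rewrite -(ler_nat R) -subr_ge0 (le_trans _ h2)// mulr_ge0// ltW.
rewrite -(ler_nat R) natrM !natrX natrB//.
apply: (le_trans (y := (t * (d k)%:R) ^+ (2 * m))).
  by rewrite exprMn ler_wpM2r// exprn_ge0// ltW.
by rewrite lerXn2r// nnegrE ?mulr_ge0// ?(ltW dR)// subr_ge0 ler_nat.
Qed.

Lemma recursive_deviates m u d f g :
  recursive (fun e => u (nth 0%N e 0)) -> recursive (fun e => d (nth 0%N e 0)) ->
  recursive f -> recursive g -> recursive (fun x => deviates m u d (f x) (g x)).
Proof.
move=> ru rd rf rg.
have rdf := recursive_subst1 rd rf; have ruf := recursive_subst1 ru rf.
have rND := recursive_mul rg rdf; have rku := recursive_mul rf ruf.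
have r2m := recursive_const (2 * m).
apply: recursive_leq.
  apply: recursive_mul; apply: recursive_exp => //; exact: recursive_const.
apply: recursive_exp => //; apply: recursive_sub => //.
by apply: recursive_add; exact: recursive_sub.
Qed.

(** * The Schnorr test *)

Lemma recursive_bit f g : recursive f -> recursive g ->
  recursive (fun x => bit (f x) (g x)).
Proof.
move=> rf rg; have := recursive_mod
  (recursive_div rf (recursive_exp (recursive_const 2) rg)) (recursive_const 2).
by congr recursive; apply/funext => x; rewrite modn2.
Qed.

(** The test event cut off at time [L]: it depends on [L] bits only, so its probability is a finite
    sum. *)
Definition hits (D : nat -> nat -> bool) (K L : nat) (s : seq bool) : bool :=
  [exists j : 'I_L.+1, (K < j)%N && D j (count id (take j s))].

Lemma count_mkseq_bit v j L : (j <= L)%N ->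
  count id (take j (mkseq (bit v) L)) = (\sum_(i < j) bit v i)%N.
Proof.
move=> jL; rewrite take_mkseq//; elim: j {jL} => [|j IH]; first by rewrite big_ord0.
by rewrite mkseqS -cats1 count_cat IH big_ord_recr /= addn0.
Qed.

Lemma hits_bits D K L v :
  hits D K L (mkseq (bit v) L) =
  (0 < \sum_(j < L.+1) ((K < j) && D j (\sum_(i < j) bit v i)%N))%N.
Proof.
rewrite lt0n sum_nat_eq0 negb_forall; apply: eq_existsb => j.
by rewrite count_mkseq_bit ?eqb0 ?negbK// -ltnS.
Qed.

Lemma bern_letter (R : realType) (Omega : alphabetType)
    (P : finProbSpace R Omega) (a : Omega) :
  (fun b => \sum_(c | pred1 a c == b) P c) = bern (P a).
Proof.
apply/funext => -[] /=.
  by rewrite (eq_bigl (pred1 a)) ?big_pred1_eq// => c /=; case: eqP.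
have := fps_sum1 P; rewrite (bigD1 a)//= => <-; rewrite addrAC subrr add0r.
by apply: eq_bigl => c; rewrite eqbF_neg.
Qed.

Lemma fps_itv (R : realType) (Omega : alphabetType)
    (P : finProbSpace R Omega) (a : Omega) : 0 <= P a <= 1.
Proof.
rewrite fps_ge0 -(fps_sum1 P) (bigD1 a)//= lerDl sumr_ge0// => c _.
exact: fps_ge0.
Qed.

Lemma bernoulli_letter (R : realType) (Omega : alphabetType)
    (P : finProbSpace R Omega) (a : Omega) L (Q : pred (seq bool)) :
  bernoulli_measure P [set beta | Q (map (pred1 a) (mkseq beta L))] =
  (expect (bern (P a)) L (fun s => (Q s)%:R))%:E.
Proof.
rewrite (bernoulli_expect P L (fun s => Q (map (pred1 a) s))) -bern_letter.
by rewrite (expect_map (pred1 a) P L (fun s => (Q s)%:R)).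
Qed.

Lemma prefix_set_hits (Omega : alphabetType) (a : Omega) D K :
  prefix_set [set s | (K < size s)%N && D (size s) (count_mem a s)] =
  \bigcup_L [set beta : iseq Omega |
               hits D K L (map (pred1 a) (mkseq beta L))].
Proof.
apply/seteqP; split=> [beta [n /=]|beta [L _] /existsP[j]].
  rewrite size_mkseq => /andP[Kn Dn]; exists n => //; apply/existsP.
  exists (Ordinal (ltnSn n)).
  by rewrite /= Kn take_oversize ?size_map ?size_iota// count_map.
have jL : (j <= L)%N by rewrite -ltnS.
rewrite -map_take take_mkseq// count_map => /andP[Kj Dj].
by exists j; rewrite /= size_mkseq Kj.
Qed.

Lemma hits_nondecreasing (Omega : alphabetType) (a : Omega) D K :
  nondecreasing_seq (fun L => [set beta : iseq Omega |
               hits D K L (map (pred1 a) (mkseq beta L))]).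
Proof.
move=> L L' LL'; apply/subsetPset => beta /existsP[j].
have jL : (j <= L)%N by rewrite -ltnS.
rewrite -map_take take_mkseq// => h; apply/existsP.
exists (widen_ord (LL' : L.+1 <= L'.+1)%N j).
by rewrite /= -map_take take_mkseq// (leq_trans jL).
Qed.

(** A hit up to time [L.+1] occurs by time [L] or at [L.+1] itself. The union bound is taken in the
    Bernoulli measure, where words of both lengths live on one space. *)
Lemma expect_hits_succ (R : realType) (Omega : alphabetType)
    (P : finProbSpace R Omega) (a : Omega) D K L :
  expect (bern (P a)) L.+1 (fun s => (hits D K L.+1 s)%:R) <=
  expect (bern (P a)) L (fun s => (hits D K L s)%:R) +
  expect (bern (P a)) L.+1 (fun s => (D L.+1 (count id s))%:R).
Proof.
rewrite -lee_fin EFinD -(bernoulli_letter P a L.+1 (hits D K L.+1)).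
rewrite -(bernoulli_letter P a L (hits D K L)).
rewrite -(bernoulli_letter P a L.+1 (fun s => D L.+1 (count id s))).
pose V L' (Q : pred (seq bool)) :=
  [set beta : iseq Omega | Q (map (pred1 a) (mkseq beta L'))].
have mV L' Q : measurable (V L' Q).
  exact: (@measurable_mkseq Omega L' (fun s => Q (map (pred1 a) s))).
apply: (le_trans _ (measureU2 _ (mV L (hits D K L))
  (mV L.+1 (fun s => D L.+1 (count id s))))).
apply: le_measure; rewrite ?inE; [exact: (mV _ (hits D K L.+1))|exact: measurableU|].
move=> beta /existsP[j] /andP[Kj].
have jL : (j <= L.+1)%N by rewrite -ltnS.
rewrite -map_take take_mkseq// => Dj.
move: jL; rewrite leq_eqVlt => /orP[/eqP jE|jL]; [right|left].
  by rewrite /= -jE.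
apply/existsP; exists (Ordinal jL); rewrite /= Kj -map_take take_mkseq//.
Qed.

(** No [j] satisfies [K < j <= K]. Starting the tail estimate at [L = K] therefore bounds the
    measure of the whole test section. *)
Lemma expect_hits_self (R : realType) (p : R) D K :
  expect (bern p) K (fun s => (hits D K K s)%:R) = 0.
Proof.
rewrite (eq_expect _ (G := fun=> 0 * 1)) => [|s _].
  by rewrite expectZ mul0r.
rewrite mul0r; have [/existsP[j /andP[]]|//] := boolP (hits D K K s).
by rewrite ltnNge -ltnS ltn_ord.
Qed.

(** The cut-off events increase to the full event, so it suffices to bound each of them; the sum of
    [B / k ^ 2] over [k > L] telescopes to at most [B / L]. *)
Lemma bernoulli_prefix_set_hits (R : realType) (Omega : alphabetType)
    (P : finProbSpace R Omega) (a : Omega) (D : nat -> nat -> bool) K (B : R) L :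
  0 <= B ->
  (forall k, (0 < k)%N ->
    expect (bern (P a)) k (fun s => (D k (count id s))%:R) <= B / k%:R ^+ 2) ->
  (0 < K <= L)%N ->
  (let lam := bernoulli_measure P (prefix_set
     [set s | (K < size s)%N && D (size s) (count_mem a s)]) in
   let V := expect (bern (P a)) L (fun s => (hits D K L s)%:R) in
   V%:E <= lam <= (V + B / L%:R)%:E)%E.
Proof.
move=> B0 hD /andP[K0 KL] /=; rewrite prefix_set_hits.
pose V L := [set beta : iseq Omega | hits D K L (map (pred1 a) (mkseq beta L))].
have mV n : measurable (V n).
  exact: (@measurable_mkseq Omega n (fun s => hits D K n (map (pred1 a) s))).
have VE n : bernoulli_measure P (V n) =
    (expect (bern (P a)) n (fun s => (hits D K n s)%:R))%:E.
  exact: bernoulli_letter.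
have mU : measurable (\bigcup_n V n) by exact: bigcup_measurable.
apply/andP; split.
  rewrite -VE; apply: le_measure; rewrite ?inE//.
  exact: bigcup_sup.
have := nondecreasing_cvg_mu (mu := bernoulli_measure P) mV mU
  (@hits_nondecreasing _ a D K).
apply: cvge_le; exists L => // n /= Ln.
rewrite VE lee_fin.
(* The induction on [n] needs the sharper bound with [- B / n] kept. *)
apply: (le_trans (y := expect (bern (P a)) L (fun s => (hits D K L s)%:R) +
   (B / L%:R - B / n%:R))); last first.
  by rewrite lerD2l gerBl divr_ge0.
have L0 : (0 < L)%N by exact: leq_trans KL.
elim: n Ln => [|n IH]; first by rewrite leqn0 -leqn0 leqNgt L0.
rewrite leq_eqVlt ltnS => /orP[/eqP <-|Ln]; first by rewrite subrr addr0.
have n0 : (0 < n)%N by exact: leq_trans Ln.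
apply: (le_trans (expect_hits_succ P a D K n)).
apply: (le_trans (lerD (IH Ln) (hD n.+1 _))) => //.
(* The telescoping step: [1 / (n + 1) ^ 2] is at most [1 / (n * (n + 1))], which is
   [1 / n - 1 / (n + 1)]. *)
suff : B / n.+1%:R ^+ 2 <= B / n%:R - B / n.+1%:R.
  by move=> h; rewrite -addrA lerD2l -addrA lerD2l -lerBrDl opprK addrC.
have nR : 0 < n%:R :> R by rewrite ltr0n.
have n1 : 0 < n%:R + 1 :> R by rewrite addr_gt0.
rewrite -mulrBr ler_wpM2l// -natr1.
rewrite (_ : n%:R^-1 - _ = (n%:R * (n%:R + 1))^-1); last first.
  by field; rewrite !gt_eqF.
by rewrite lef_pV2 ?posrE ?exprn_gt0 ?mulr_gt0// expr2 ler_pM2r// lerDl.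
Qed.

(** At the rational probability [x / y] every word of length [L] has a weight with denominator
    [y ^ L], and its numerator is a product of factors [x] and [y - x]. *)
Definition hits_numerator (D : nat -> nat -> bool) (K L x y : nat) : nat :=
  (\sum_(v < 2 ^ L) \prod_(i < L) (if bit v i then x else y - x) *
     (0 < \sum_(j < L.+1) ((K < j) && D j (\sum_(i < j) bit v i))))%N.

Lemma expect_hits_frac (R : realType) D K L (x y : nat) :
  (0 < y)%N -> (x <= y)%N ->
  expect (bern (x%:R / y%:R : R)) L (fun s => (hits D K L s)%:R) =
  (hits_numerator D K L x y)%:R / (y ^ L)%:R.
Proof.
move=> y0 xy; rewrite expect_bits /hits_numerator natr_sum mulr_suml.
apply: eq_bigr => v _; rewrite hits_bits natrM mulrAC; congr (_ * _).
rewrite natr_prod natrX -[L in _ ^+ L]card_ord -prodr_const -prodf_div.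
apply: eq_bigr => i _; rewrite /bern; case: (bit v i) => //.
by rewrite natrB// mulrBl divff// pnatr_eq0 -lt0n.
Qed.

Lemma recursive_hits_numerator (D : nat -> nat -> bool) fK fL fx fy :
  recursive (fun e => D (nth 0%N e 0) (nth 0%N e 1)) ->
  recursive (fun e => fK (nth 0%N e 0) (nth 0%N e 1)) ->
  recursive (fun e => fL (nth 0%N e 0) (nth 0%N e 1)) ->
  recursive (fun e => fx (nth 0%N e 0) (nth 0%N e 1)) ->
  recursive (fun e => fy (nth 0%N e 0) (nth 0%N e 1)) ->
  recursive (fun e => let n := nth 0%N e 0 in let k := nth 0%N e 1 in
    hits_numerator D (fK n k) (fL n k) (fx n k) (fy n k)).
Proof.
move=> rD rK rL rx ry.
(* Each enclosing sum or product moves the parameters [n] and [k] one place up in the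
   environment. *)
have shift g i : recursive (fun e => g (nth 0%N e 0) (nth 0%N e 1)) ->
    recursive (fun e => g (nth 0%N e i) (nth 0%N e i.+1)).
  by move=> rg; exact: (recursive_subst2 rg (recursive_var i) (recursive_var i.+1)).
pose ones j v := (\sum_(i < j) bit v i)%N.
have rones f g : recursive f -> recursive g -> recursive (fun e => ones (f e) (g e)).
  move=> rf rg; apply: (recursive_subst2
    (g := fun e => ones (nth 0%N e 0) (nth 0%N e 1))) => //.
  exact: (recursive_sum (h := fun e => bit (nth 0%N e 2) (nth 0%N e 0))
    (recursive_var 0) (recursive_bit (recursive_var 2) (recursive_var 0))).
apply: (recursive_sum (f := fun e => (2 ^ fL (nth 0 e 0) (nth 0 e 1))%N)
  (h := fun e => (\prod_(i < fL (nth 0 e 1) (nth 0 e 2))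
     (if bit (nth 0 e 0) i then fx (nth 0 e 1) (nth 0 e 2)
      else fy (nth 0 e 1) (nth 0 e 2) - fx (nth 0 e 1) (nth 0 e 2)) *
     (0 < \sum_(j < (fL (nth 0 e 1) (nth 0 e 2)).+1)
        ((fK (nth 0 e 1) (nth 0 e 2) < j) && D j (ones j (nth 0 e 0)))))%N)).
  by apply: recursive_exp => //; exact: recursive_const.
apply: recursive_mul.
  apply: (recursive_prod (f := fun e => fL (nth 0%N e 1) (nth 0%N e 2))
    (h := fun e => (if bit (nth 0 e 1) (nth 0 e 0) then fx (nth 0 e 2) (nth 0 e 3)
      else fy (nth 0 e 2) (nth 0 e 3) - fx (nth 0 e 2) (nth 0 e 3))%N)).
    exact: (shift fL 1%N).
  apply: recursive_if; [|exact: (shift fx 2%N)|].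
    exact: recursive_bit (recursive_var 1) (recursive_var 0).
  by apply: recursive_sub; [exact: (shift fy 2%N)|exact: (shift fx 2%N)].
apply: recursive_leq; first exact: recursive_const.
apply: (recursive_sum (f := fun e => (fL (nth 0%N e 1) (nth 0%N e 2)).+1)
  (h := fun e => ((fK (nth 0 e 2) (nth 0 e 3) < nth 0 e 0) &&
     D (nth 0 e 0) (ones (nth 0 e 0) (nth 0 e 1)))%N)).
  by apply: recursive_succ; exact: (shift fL 1%N).
apply: recursive_and.
  apply: recursive_leq; last exact: recursive_var.
  by apply: recursive_succ; exact: (shift fK 2%N).
exact: (recursive_subst2 rD (recursive_var 0)
  (rones _ _ (recursive_var 0) (recursive_var 1))).
Qed.

Lemma ranks_surj (T : finType) t : all (fun i => i < #|T|)%N t ->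
  exists s : seq T, [seq nat_of_ord (enum_rank a) | a <- s] = t.
Proof.
elim: t => [|i t IH] /=; first by exists [::].
move=> /andP[iT /IH[s <-]]; exists (enum_val (Ordinal iT) :: s).
by rewrite /= enum_valK.
Qed.

Definition size_count_test (Omega : eqType) (a : Omega) (K : nat -> nat)
    (D : nat -> nat -> bool) : set (nat * seq Omega) :=
  [set q | [&& (0 < q.1)%N, (K q.1 < size q.2)%N & D (size q.2) (count_mem a q.2)]].

Lemma re_size_count_test (Omega : finType) (a : Omega) K (D : nat -> nat -> bool) :
  recursive (fun e => K (nth 0%N e 0)) ->
  recursive (fun e => D (nth 0%N e 0) (nth 0%N e 1)) ->
  re_pairs (size_count_test a K D).
Proof.
move=> rK rD.
pose r := nat_of_ord (enum_rank a).
(* Every number codes a list of naturals. The first conjunct checks that all entries are ranks of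
   letters, so that the list comes from a string. *)
pose b (e : seq nat) := let n := nth 0%N e 0 in let c := nth 0%N e 1 in
  [&& (\sum_(i < code_size c) (#|Omega| <= code_nth c i) == 0)%N, (0 < n)%N,
      (K n < code_size c)%N & D (code_size c) (code_count r c)].
have rb : recursive b.
  have rc := recursive_var 1.
  have rs := recursive_code_size rc.
  apply: recursive_and.
    apply: recursive_eq; last exact: recursive_const.
    apply: (recursive_sum (f := fun e => code_size (nth 0%N e 1))
      (h := fun e => (#|Omega| <= code_nth (nth 0 e 2) (nth 0 e 0))%N)) => //.
    apply: recursive_leq; first exact: recursive_const.
    exact: recursive_code_nth (recursive_var 2) (recursive_var 0).
  apply: recursive_and.
    exact: recursive_leq (recursive_const 1) (recursive_var 0).
  apply: recursive_and.
    exact: recursive_leq (recursive_succ rK) rs.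
  exact: (recursive_subst2 rD rs (recursive_code_count r rc)).
have := re_set_recursive 2 rb; congr re_set.
have countE s : count_mem r [seq nat_of_ord (enum_rank x) | x <- s] = count_mem a s.
  rewrite count_map; apply: eq_count => x /=.
  by rewrite (inj_eq val_inj) (inj_eq enum_rank_inj).
apply/seteqP; split=> [x /=|_ [[n s] /= /and3P[n0 Ks Ds] <-]]; last first.
  rewrite /b /string_code /= code_sizeE code_countE countE size_map n0 Ks Ds !andbT.
  rewrite sum_nat_eq0; apply/forallP => i; rewrite eqb0 -ltnNge code_nthE.
  by rewrite (nth_map a) ltn_ord.
rewrite /b; case/and4P; set n := nth _ x 0; set c := nth _ x 1.
rewrite -[c]CodeSeq.decodeK; set t := CodeSeq.decode c.
rewrite code_sizeE code_countE sum_nat_eq0 => /forallP allt n0 Kt Dt.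
have /ranks_surj[s st] : all (fun i => i < #|Omega|)%N t.
  apply/(all_nthP 0%N) => i it; have := allt (Ordinal it).
  by rewrite eqb0 -ltnNge code_nthE.
exists (n, s) => /=.
  rewrite /size_count_test /= n0 -countE st.
  by rewrite -(size_map (fun x => nat_of_ord (enum_rank x))) st Kt.
apply: eq_from_tnth => i; rewrite !(tnth_nth 0%N) /string_code /= st CodeSeq.decodeK.
by case: i => -[|[|]].
Qed.

Lemma schnorr_size_count_test (R : realType) (Omega : alphabetType)
    (P : finProbSpace R Omega) (a : Omega) (D : nat -> nat -> bool)
    (u d : nat -> nat) (B : nat) :
  recursive (fun e => u (nth 0%N e 0)) -> recursive (fun e => d (nth 0%N e 0)) ->
  (forall k, (0 < d k)%N) -> (forall k, (u k <= d k)%N) ->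
  (forall k, `|P a - (u k)%:R / (d k)%:R| < 2^-1 ^+ k) ->
  recursive (fun e => D (nth 0%N e 0) (nth 0%N e 1)) -> (0 < B)%N ->
  (forall k, (0 < k)%N ->
    expect (bern (P a)) k (fun s => (D k (count id s))%:R) <= B%:R / k%:R ^+ 2) ->
  schnorr_test P (size_count_test a (fun n => B * 2 ^ n.+1)%N D).
Proof.
move=> ru rd d0 ud pu rD B0 hD.
pose K n := (B * 2 ^ n.+1)%N.
have K0 n : (0 < K n)%N by rewrite muln_gt0 B0 expn_gt0.
have rK : recursive (fun e => K (nth 0%N e 0)).
  apply: recursive_mul; first exact: recursive_const.
  apply: recursive_exp; first exact: recursive_const.
  exact: recursive_succ (recursive_var 0).
have secE n : (0 < n)%N -> test_section (size_count_test a K D) n =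
    [set s | (K n < size s)%N && D (size s) (count_mem a s)].
  by move=> n0; apply/seteqP; split=> s; rewrite /test_section/size_count_test /= n0.
have tail n L : (K n <= L)%N ->
  let lam := bernoulli_measure P (prefix_set
     [set s | (K n < size s)%N && D (size s) (count_mem a s)]) in
  let V := expect (bern (P a)) L (fun s => (hits D (K n) L s)%:R) in
  (V%:E <= lam <= (V + B%:R / L%:R)%:E)%E.
  by move=> KL; apply: bernoulli_prefix_set_hits; rewrite ?K0.
have BK j : B%:R / (B * 2 ^ j)%:R = 2^-1 ^+ j :> R.
  by rewrite natrM invfM mulrA divff ?mul1r ?natrX ?exprVn// pnatr_eq0 -lt0n.
split.
  split; [by move=> q /and3P[]|exact: re_size_count_test|] => n n0.
  (* At the cut-off [K n] no hit is possible, so only the tail [B / K n] remains, which is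
     [2^-1 ^+ n.+1]. *)
  rewrite secE//; have /andP[_] := tail n _ (leqnn (K n)).
  rewrite expect_hits_self add0r BK => /le_lt_trans; apply.
  by rewrite lte_fin exprS gtr_pMl ?exprn_gt0//; lra.
(* The cut-off error [B / L n k] is [2^-1 ^+ (n + k.+1)], at most [2^-1 ^+ k.+2] because [n] is
   positive. *)
pose L n k := (B * 2 ^ (n + k.+1))%N.
(* In the error [L * (2 * 2^-1 ^+ M)] from [expect_close], the summand [L] of [M] cancels the factor
   [L], leaving [2 * 2^-1 ^+ k.+2]. Both errors together are at most three quarters of
   [2^-1 ^+ k]. *)
pose M n k := (L n k + k.+2)%N.
have rL : recursive (fun e => L (nth 0%N e 0) (nth 0%N e 1)).
  apply: recursive_mul; first exact: recursive_const.
  apply: recursive_exp; first exact: recursive_const.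
  exact: recursive_add (recursive_var 0) (recursive_succ (recursive_var 1)).
have rM : recursive (fun e => M (nth 0%N e 0) (nth 0%N e 1)).
  by apply: recursive_add => //; do 2 apply: recursive_succ; exact: recursive_var.
pose num n k := hits_numerator D (K n) (L n k) (u (M n k)) (d (M n k)).
pose den n k := (d (M n k) ^ L n k)%N.
have den0 n k : (0 < den n k)%N by rewrite expn_gt0 d0.
have rnum : recursive (fun e => num (nth 0%N e 0) (nth 0%N e 1)).
  apply: (recursive_hits_numerator (fK := fun n _ => K n) (fL := L)
    (fx := fun n k => u (M n k)) (fy := fun n k => d (M n k))) => //.
    exact: recursive_subst1 ru rM.
  exact: recursive_subst1 rd rM.
have rden : recursive (fun e => den (nth 0%N e 0) (nth 0%N e 1)).
  by apply: recursive_exp => //; exact: recursive_subst1 rd rM.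
exists (fun n k => (num n k)%:R / (den n k)%:R).
  (* The format of [total_recursive_rat] adds 1 to the denominator, hence the predecessor. *)
  exists (fun v => num (nth 0%N v 0) (nth 0%N v 1)), (fun=> 0%N),
    (fun v => (den (nth 0%N v 0) (nth 0%N v 1)).-1).
  split; [exact: rnum|exact: recursive_const|exact: (recursive_pred rden)|] => v.
  by rewrite prednK// subr0 !(tnth_nth 0%N).
move=> n k n0; rewrite secE// fmorph_div /= !ratr_nat.
rewrite -(@expect_hits_frac R D (K n))//.
set q := _ / _; set lam := bernoulli_measure P _.
have KL : (K n <= L n k)%N by rewrite leq_mul2l leq_exp2l//; lia.
have := tail n _ KL; rewrite -/lam.
set V := expect _ _ _; move=> /= /andP[lamV Vlam].
have lamE : lam = (fine lam)%:E.
  by rewrite fineK// ge0_fin_numE ?measure_ge0// (le_lt_trans Vlam) ?ltry.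
move: lamV Vlam; rewrite {1 2}lamE !lee_fin => lamV Vlam.
have q01 : 0 <= q <= 1.
  by rewrite divr_ge0//= ler_pdivrMr ?ltr0n// mul1r ler_nat.
have p01 := fps_itv P a.
have bern0 (p : R) : 0 <= p <= 1 -> forall b, 0 <= bern p b.
  by move=> /andP[? ?] [] //=; rewrite subr_ge0.
have bern1 (p : R) : \sum_b bern p b = 1 by rewrite big_bool /= addrC subrK.
have close : \sum_b `|bern (P a) b - bern q b| <= 2 * 2^-1 ^+ M n k.
  rewrite big_bool /= [X in _ + `|X|](_ : _ = - (P a - q)); last by ring.
  rewrite normrN -mulr2n -[leLHS]mulr_natl ler_wpM2l//; exact: ltW (pu _).
have := expect_close (L n k) (G := fun s => (hits D (K n) (L n k) s)%:R)
  (bern0 _ p01) (bern1 _) (bern0 _ q01) (bern1 _) close.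
have G01 s : 0 <= ((hits D (K n) (L n k) s)%:R : R) <= 1.
  by case: hits; rewrite lexx ler01.
move=> /(_ G01); rewrite -/V => VW.
have e1 : B%:R / (L n k)%:R <= 2^-1 ^+ k.+2 :> R.
  by rewrite BK; apply: ler_wiXn2l; [lra|lra|lia].
have e2 : (L n k)%:R * (2 * 2^-1 ^+ M n k) <= 2 * 2^-1 ^+ k.+2 :> R.
  rewrite mulrCA ler_wpM2l// exprD mulrA ler_piMl ?exprn_ge0//.
  exact: natr_mul_exp2V_le1.
rewrite (le_lt_trans (ler_distD V _ _))//.
rewrite ger0_norm ?subr_ge0//.
have k0 : 0 < 2^-1 ^+ k :> R by rewrite exprn_gt0.
move: e1 e2; rewrite !exprS => e1 e2; lra.
Qed.

(** * Rate of convergence *)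

(** A level [n] of the test that [alpha] avoids yields the threshold [tail_cst m * 2 ^ n.+1], past
    which no prefix deviates. The rate enters through any [t] with [k ^ m.+1 <= t ^ (2 * m)], which
    postpones real powers. *)
Lemma schnorr_random_deviation (R : realType) (Omega : alphabetType)
    (P : finProbSpace R Omega) (alpha : nat -> Omega) (a : Omega) (m : nat) :
  computable_fps P -> schnorr_random P alpha -> (0 < m)%N ->
  exists K : nat, forall (k : nat) (t : R), (K < k)%N -> 0 <= t ->
    k%:R ^+ m.+1 <= t ^+ (2 * m) ->
    `|(count_mem a (mkseq alpha k))%:R - k%:R * P a| <= t + 2.
Proof.
move=> cP ralpha m0.
have p01 := fps_itv P a.
have [u [d [ru rd d0 ud pu]]] := computable_unit_interval p01 (cP a).
have rD : recursive (fun e => deviates m u d (nth 0%N e 0) (nth 0%N e 1)).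
  exact: (recursive_deviates m ru rd (recursive_var 0) (recursive_var 1)).
have hD k : (0 < k)%N ->
    expect (bern (P a)) k (fun s => (deviates m u d k (count id s))%:R) <=
    (tail_cst m)%:R / k%:R ^+ 2.
  move=> k0; apply: le_trans (tail_dev p01 m0 k0); apply: le_expect.
    by case/andP: p01 => ? ? [] //=; rewrite subr_ge0.
  move=> s _; have [h|_] := boolP (deviates m u d k (count id s)); last by rewrite ler0n.
  by rewrite (deviates_ge m0 k0 (d0 k) (pu k) h).
have [n n0] := ralpha _ (schnorr_size_count_test ru rd d0 ud pu rD (tail_cst_gt0 m0) hD).
move=> nalpha; exists (tail_cst m * 2 ^ n.+1)%N => k t Kk t0 kt.
apply: (deviates_le (d0 k) (pu k) t0 kt); apply/negP => dev; apply: nalpha.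
by exists k; rewrite /test_section /size_count_test /= size_mkseq n0 Kk.
Qed.

(** Grouping by letters makes the values of [X] mere coefficients of the letter counts, so
    deviations of the counts control the average. *)
Lemma sum_count_mem (R : realType) (T : finType) (X : T -> R) (s : seq T) :
  \sum_(x <- s) X x = \sum_a X a * (count_mem a s)%:R.
Proof.
elim: s => [|x s IH]; first by rewrite big_nil big1// => a _; rewrite mulr0.
rewrite big_cons IH; under [RHS]eq_bigr do rewrite /= natrD mulrDr.
rewrite big_split/=; congr (_ + _); rewrite (bigD1 x)//= eqxx mulr1 big1 ?addr0//.
by move=> a /negbTE; rewrite eq_sym => ->; rewrite mulr0.
Qed.

(** The quantity equals [(m * eps - (2 + eps)) / (2 * m * (2 + eps))], so any [m] above
    [(2 + eps) / eps] will do. It is the power of [k] left over to absorb constants. *)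
Lemma exists_exponent (R : realType) (eps : R) : 0 < eps ->
  exists2 m : nat, (0 < m)%N &
    0 < 1 - m.+1%:R / (2 * m)%:R - (2 + eps)^-1.
Proof.
move=> e0; have e2 : 0 < 2 + eps by lra.
exists (Num.bound ((2 + eps) / eps)).+1 => //.
set m := (Num.bound _).+1; have mR : 0 < m%:R :> R by rewrite ltr0n.
have : (2 + eps) / eps < m%:R.
  by rewrite (lt_trans (archi_boundP _)) ?divr_ge0 ?ltW// ltr_nat.
rewrite ltr_pdivrMr// => h.
rewrite natrM -(natr1 m).
rewrite [ltRHS](_ : _ = (m%:R * eps - (2 + eps)) / (2 * m%:R * (2 + eps))).
  by rewrite divr_gt0 ?mulr_gt0// subr_gt0.
by field; rewrite !gt_eqF.
Qed.

Theorem theorem17 (R : realType) (Omega : alphabetType)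
    (P : finProbSpace R Omega) (hP : computable_fps P)
    (X : Omega -> R) (alpha : nat -> Omega) (halpha : schnorr_random P alpha)
    (eps : R) (heps : 0 < eps) :
  exists2 M : nat, (0 < M)%N &
    forall n k : nat, (M <= n)%N -> (0 < k)%N ->
      n%:R `^ (2 + eps) <= k%:R :> R ->
      `|k%:R^-1 * (\sum_(i < k) X (alpha i)) - mean P X| < n%:R^-1.
Proof.
have [m m0] := exists_exponent heps; set th := _ / _; set g := _ - _ => g0.
have e2 : 0 < 2 + eps by lra.
have [K hK] := choice (fun a => schnorr_random_deviation a hP halpha m0).
(* The 3 comes from [t + 2 <= 3 * t] for [t >= 1]; the added 1 makes the final inequality strict. *)
pose C : R := 3 * (\sum_a `|X a|) + 1.
have C0 : 0 < C by rewrite ltr_wpDl// mulr_ge0// sumr_ge0.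
(* The first bound passes the thresholds of all letters, the second ensures [C <= k ^ g]; both
   transfer from [n] to [k] since [n <= n ^ (2 + eps) <= k]. *)
pose M := (maxn (\max_a K a) (Num.bound (C `^ g^-1))).+1.
exists M => // n k Mn k0 nk.
have n0 : (0 < n)%N by exact: leq_trans Mn.
have n1 : 1 <= n%:R :> R by rewrite ler1n.
have k1 : 1 <= k%:R :> R by rewrite ler1n.
have kR : 0 < k%:R :> R by rewrite ltr0n.
have nlek : (n <= k)%N.
  by rewrite -(ler_nat R) (le_trans _ nk)// le1r_powR//; lra.
have Mk : (M <= k)%N by exact: leq_trans nlek.
have Kk a : (K a < k)%N.
  rewrite (leq_trans _ Mk)// ltnS (leq_trans _ (leq_maxl _ _))//.
  exact: leq_bigmax.
have Ck : C <= k%:R `^ g.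
  have CE : C = (C `^ g^-1) `^ g by rewrite -powRrM mulVf ?gt_eqF// powRr1 ?ltW.
  rewrite [leLHS]CE.
  apply: ge0_ler_powR; rewrite ?nnegrE ?powR_ge0 ?(ltW g0)//.
  apply: (le_trans (ltW (archi_boundP (powR_ge0 _ _)))); rewrite ler_nat.
  by rewrite (leq_trans _ Mk)// leqW// leq_maxr.
have nk' : n%:R <= k%:R `^ (2 + eps)^-1.
  have nE : n%:R = (n%:R `^ (2 + eps)) `^ (2 + eps)^-1 :> R.
    by rewrite -powRrM mulfV ?gt_eqF// powRr1.
  rewrite [leLHS]nE.
  by apply: ge0_ler_powR; rewrite ?nnegrE ?powR_ge0 ?invr_ge0 ?(ltW e2).
pose t : R := k%:R `^ th.
have t1 : 1 <= t.
  by rewrite -(powRr0 k%:R) ler_powR// divr_ge0.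
(* The three factors of [k] dominate, in order, the constant [C], the factor [n] and the
   deviation. *)
have kE : k%:R = k%:R `^ g * k%:R `^ (2 + eps)^-1 * t.
  rewrite /t -!powRD ?(gt_eqF kR) ?implybT// -[LHS]powRr1 ?ltW//.
  by congr powR; rewrite /g; ring.
have tk : k%:R ^+ m.+1 <= t ^+ (2 * m).
  by rewrite -!powR_mulrn ?powR_ge0// -powRrM divfK// pnatr_eq0 muln_eq0 -!lt0n.
have dev a : `|(count_mem a (mkseq alpha k))%:R - k%:R * P a| <= 3 * t.
  by rewrite (le_trans (hK a k t (Kk a) _ tk))//; lra.
have -> : k%:R^-1 * (\sum_(i < k) X (alpha i)) - mean P X =
    k%:R^-1 * \sum_a X a * ((count_mem a (mkseq alpha k))%:R - k%:R * P a).
  have -> : \sum_(i < k) X (alpha i) = \sum_(x <- mkseq alpha k) X x.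
    by rewrite big_map -(big_mkord xpredT (X \o alpha)) /index_iota subn0.
  rewrite sum_count_mem; apply: (mulfI (lt0r_neq0 kR)).
  rewrite mulrBr !mulVKf ?gt_eqF// /mean mulr_sumr -sumrB.
  by apply: eq_bigr => a _; ring.
rewrite normrM ger0_norm ?invr_ge0 ?ltW// mulrC ltr_pdivrMr//.
rewrite mulrC ltr_pdivlMr ?ltr0n//.
(* With denominators cleared, the goal is that the weighted sum of deviations times [n] is below
   [k]. *)
apply: (le_lt_trans (y := ((C - 1) * t) * k%:R `^ (2 + eps)^-1)).
  apply: ler_pM => //; rewrite /C addrK (le_trans (ler_norm_sum _ _ _))//.
  rewrite [3 * _]mulrC -mulrA mulr_suml ler_sum// => a _.
  by rewrite normrM ler_wpM2l.
rewrite [ltRHS]kE mulrAC ltr_pM2r ?powR_gt0//.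
by rewrite ltr_pM2r ?powR_gt0// (lt_le_trans _ Ck)// gtrBl.
Qed.
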